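(* Let $\Xi$ be a solution of the $\frac{\mathrm{O}(2n+k-1,1)}{\mathrm{O}(n)\times\mathrm{O}(n+k-1,1)}$-system defined by $\mathfrak{a}_+$ (respectively $\mathfrak{a}_-$), $\Phi_\lambda$ an extended flat frame for the Lax pair of $\Xi$, and $\mathbf{c}\in\mathbb{R}^{n+k-1,1}$ a non-zero null vector. Then $\Phi_0=\begin{pmatrix}g_1&0\\ 0&g_2\end{pmatrix}$, and, wherever it is an immersion, $F=\Phi_1\begin{pmatrix}0\\ g_2^{-1}\mathbf{c}\end{pmatrix}$ is flat with flat normal bundle and uniform multiplicity one, and the subbundle $N_v^\perp$ is flat. A different choice of non-zero null vector $\mathbf{b}$ yields a Combescure transform $F_{\mathbf{b}}=\Phi_1\begin{pmatrix}0\\ g_2^{-1}\mathbf{b}\end{pmatrix}$ of $F$ (where both are immersions).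
   Context: $\mathrm{I}_{m,1}=\operatorname{diag}(1,\dots,1,-1)$ (size $m+1$); $\mathbb{R}^{m,1}$ is $\mathbb{R}^{m+1}$ with $(x,y)=x^T\mathrm{I}_{m,1}y$. $F$ takes values in the light-cone of $\mathbb{R}^{2n+k-1,1}$, $k\ge0$. $F$ flat means its induced metric is flat. $N_F$ is the orthogonal complement of the tangent bundle in the trivial $\mathbb{R}^{2n+k-1,1}$-bundle; it is flat if the normal connection is flat. For flat normal bundle, curvature distributions are the common eigenspaces $E_i$ of all shape operators $A_v$ ($A_v$ = tangential part of $-dv$), with curvature normals $v_i$ defined by $A_v|_{E_i}=(v,v_i)\operatorname{Id}$. Uniform multiplicity one: the curvature distributions have constant ranks, all equal to one. $N_v=\langle v_1,\dots,v_n\rangle$, and $N_v^\perp$ is its orthogonal complement in $N_F$, with the induced connection. Let $J=\mathrm{I}_{n+k-1,1}$, $\rho=\operatorname{diag}(\mathrm{I}_n,-\mathrm{I}_{n+k})$, $\tau(g)=\rho g\rho^{-1}$, $\mathfrak{p}=\left\{\begin{pmatrix}0&\xi\\ -J\xi^T&0\end{pmatrix}:\xi\text{ an }n\times(n+k)\text{ real matrix}\right\}\subset\mathfrak{o}(2n+k-1,1)$. With $e_{ij}$ the elementary $(2n+k)\times(2n+k)$ matrices, $\epsilon_i=1$ for $i<n$, $\epsilon_n=-1$: $\mathfrak{a}_+$ is spanned by $a_i=e_{i,n+i}-e_{n+i,i}$, $1\le i\le n$ (used when $k\ge1$), and $\mathfrak{a}_-$ by $b_i=e_{i,n+k+i}-\epsilon_ie_{n+k+i,i}$,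 $1\le i\le n$; both are maximal abelian in $\mathfrak{p}$. The system defined by such a subalgebra $\mathfrak{a}$ with basis $c_1,\dots,c_n$ (that is, $c_i=a_i$, resp. $c_i=b_i$), for $\Xi:\mathbb{R}^n\to\mathfrak{a}^\perp\cap\mathfrak{p}$ ($\perp$ for the Killing form), is $$[c_i,\Xi_{x_j}]-[c_j,\Xi_{x_i}]-[[c_i,\Xi],[c_j,\Xi]]=0,\quad i\ne j.$$ Its Lax pair is $\theta_\lambda=\sum_i(\lambda c_i+[c_i,\Xi])dx_i$ (flat for all $\lambda\in\mathbb{C}$). An extended flat frame is a solution $\Phi_\lambda:\mathbb{R}^n\times\mathbb{C}\to\mathrm{O}(2n+k-1,1,\mathbb{C})$ of $\Phi_\lambda^{-1}d\Phi_\lambda=\theta_\lambda$ with $\overline{\Phi_\lambda}=\Phi_{\bar\lambda}$, $\tau\Phi_\lambda=\Phi_{-\lambda}$. A diffeomorphism between $n$-immersions with flat normal bundle is a Combescure transform if it maps principal directions to principal directions and corresponding directions are parallel; here the map is $F(x)\mapsto F_{\mathbf{b}}(x)$. *)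

(* Defs.v *)
From HB Require Import structures.
From mathcomp Require Import all_boot all_order all_algebra.
From mathcomp Require Import all_classical all_reals all_analysis.
From mathcomp Require Import complex.
Set Implicit Arguments.
Unset Strict Implicit.
Unset Printing Implicit Defensive.
Import Order.TTheory GRing.Theory Num.Theory.
Import numFieldNormedType.Exports.
Local Open Scope classical_set_scope.
Local Open Scope ring_scope.

Section Calculus.
Context {R : realType} {n : nat}.

Definition pd (i : 'I_n) (f : 'cV[R]_n -> R) (x : 'cV[R]_n) : R :=
  'D_(delta_mx i 0) f x.

(* [f] is C^l on [U].  [pd] is a total function; at a point of an open set its
   value, and being C^l, only depend on the germ of [f]. *)
Fixpoint Cl_on (l : nat) (U : set 'cV[R]_n) (f : 'cV[R]_n -> R) : Prop :=
  match l with
  | 0%N => forall x, U x -> {for x, continuous f}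
  | l'.+1 => (forall x i, U x -> derivable f x (delta_mx i 0)) /\
             (forall i, Cl_on l' U (pd i f))
  end.

Definition smooth_on {p q : nat} (U : set 'cV[R]_n)
    (f : 'cV[R]_n -> 'M[R]_(p, q)) : Prop :=
  forall a b l, Cl_on l U (fun x => f x a b).

Definition pdmx {p q : nat} (i : 'I_n) (f : 'cV[R]_n -> 'M[R]_(p, q))
    (x : 'cV[R]_n) : 'M[R]_(p, q) :=
  \matrix_(a, b) pd i (fun y => f y a b) x.

Definition jac {p : nat} (f : 'cV[R]_n -> 'cV[R]_p) (x : 'cV[R]_n) :
    'M[R]_(p, n) :=
  \matrix_(a, i) pd i (fun y => f y a 0) x.

Definition Csmooth {p q : nat} (f : 'cV[R]_n -> 'M[R[i]]_(p, q)) : Prop :=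
  smooth_on setT (fun x => map_mx (@complex.Re R) (f x)) /\
  smooth_on setT (fun x => map_mx (@complex.Im R) (f x)).

Definition Cpdmx {p q : nat} (i : 'I_n) (f : 'cV[R]_n -> 'M[R[i]]_(p, q))
    (x : 'cV[R]_n) : 'M[R[i]]_(p, q) :=
  \matrix_(a, b) Complex (pd i (fun y => complex.Re (f y a b)) x)
                         (pd i (fun y => complex.Im (f y a b)) x).

End Calculus.

Definition toC {R : realType} {p q : nat} (A : 'M[R]_(p, q)) : 'M[R[i]]_(p, q) :=
  map_mx (real_complex R) A.

(* I_{N-1,1} = diag(1, ..., 1, -1), of size N *)
Definition lorentz (A : pzRingType) (N : nat) : 'M[A]_N :=
  \matrix_(i, j) (if i == j then (if i.+1 == N then -1 else 1) else 0).

Section Lorentz.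
Context {R : realType} {N : nat}.

Definition ip (u v : 'cV[R]_N) : R := (u^T *m lorentz R N *m v) 0 0.

Definition orth (B : set 'cV[R]_N) : set 'cV[R]_N :=
  [set u | forall b, B b -> ip u b = 0].

(* orthogonal projection onto [B]; meaningful when [B] is a nondegenerate
   subspace, in which case the projection exists and is unique *)
Definition oproj (B : set 'cV[R]_N) (u : 'cV[R]_N) : 'cV[R]_N :=
  xget 0 [set t | B t /\ orth B (u - t)].

Definition nondegenerate (B : set 'cV[R]_N) : Prop :=
  forall u, B u -> orth B u -> u = 0.

End Lorentz.

Section Bundles.
Context {R : realType} {n N : nat}.
Implicit Types (U V : set 'cV[R]_n) (B : 'cV[R]_n -> set 'cV[R]_N).

Definition section_on V B (s : 'cV[R]_n -> 'cV[R]_N) : Prop :=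
  smooth_on V s /\ forall x, V x -> B x (s x).

(* local smooth frames: the columns of [s] *)
Definition smooth_subbundle U B : Prop :=
  forall x, U x -> exists V, [/\ open V, V x, V `<=` U &
    exists r (s : 'cV[R]_n -> 'M[R]_(N, r)), smooth_on V s /\
      forall y, V y -> \rank (s y) = r /\
        forall u, B y u <-> exists a : 'cV[R]_r, u = s y *m a].

Definition nabla B (i : 'I_n) (s : 'cV[R]_n -> 'cV[R]_N) (x : 'cV[R]_n) :
    'cV[R]_N :=
  oproj (B x) (pdmx i s x).

(* vanishing of the curvature of the induced connection; the bracket of two
   coordinate fields is zero *)
Definition flat_bundle U B : Prop :=
  [/\ smooth_subbundle U B,
      forall x, U x -> nondegenerate (B x) &
      forall V s, open V -> V `<=` U -> section_on V B s ->
        forall x i j, V x -> nabla B i (nabla B j s) x = nabla B j (nabla B i s) x].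

End Bundles.

Section Metric.
Context {R : realType} {n : nat}.
Implicit Types (g : 'cV[R]_n -> 'M[R]_n) (x : 'cV[R]_n).

(* Gamma^m_{ij} *)
Definition christoffel g (m i j : 'I_n) x : R :=
  2^-1 * \sum_l invmx (g x) m l *
    (pd i (fun y => g y j l) x + pd j (fun y => g y i l) x
     - pd l (fun y => g y i j) x).

(* R^m_{lij}: the m-th component of R(d_i, d_j) d_l *)
Definition riemann g (m l i j : 'I_n) x : R :=
  pd i (christoffel g m j l) x - pd j (christoffel g m i l) x
  + \sum_p (christoffel g m i p x * christoffel g p j l x
            - christoffel g m j p x * christoffel g p i l x).

Definition flat_metric (U : set 'cV[R]_n) g : Prop :=
  forall x, U x ->
    (forall X : 'cV[R]_n, X != 0 -> 0 < (X^T *m g x *m X) 0 0) /\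
    (forall m l i j, riemann g m l i j x = 0).

End Metric.

Section Immersions.
Context {R : realType} {n N : nat}.
Implicit Types (F : 'cV[R]_n -> 'cV[R]_N) (x X : 'cV[R]_n) (nu : 'cV[R]_N)
  (U : set 'cV[R]_n).

Definition immersion_at F x : Prop := \rank (jac F x) = n.

Definition immersion F U : Prop :=
  smooth_on U F /\ forall x, U x -> immersion_at F x.

Definition in_light_cone F : Prop := forall x, F x != 0 /\ ip (F x) (F x) = 0.

Definition induced_metric F x : 'M[R]_n :=
  (jac F x)^T *m lorentz R N *m jac F x.

Definition tangent F x : set 'cV[R]_N :=
  [set u | exists X : 'cV[R]_n, u = jac F x *m X].

Definition normal F x : set 'cV[R]_N := orth (tangent F x).

(* A_v dF(X), for [v] a normal field near [x] *)
Definition shape F (v : 'cV[R]_n -> 'cV[R]_N) x X : 'cV[R]_N :=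
  - oproj (tangent F x) (jac v x *m X).

(* A_v X = (v, nu) X for all normal fields v near x, with both sides pushed
   forward by dF *)
Definition curv_eigenspace F x nu : set 'cV[R]_n :=
  [set X | forall V v, open V -> V x -> section_on V (normal F) v ->
     shape F v x X = ip (v x) nu *: (jac F x *m X)].

Definition curvature_normal F x nu : Prop :=
  normal F x nu /\ exists2 X, X != 0 & curv_eigenspace F x nu X.

(* The columns of [nus] are the curvature normals v_1, ..., v_n: they are
   pairwise distinct, and each has a common eigenspace of rank one. *)
Definition uniform_multiplicity_one F U : Prop :=
  exists nus : 'cV[R]_n -> 'M[R]_(N, n), smooth_on U nus /\
    forall x, U x ->
      [/\ forall i j, col i (nus x) = col j (nus x) -> i = j,
          forall nu, curvature_normal F x nu <-> exists i, nu = col i (nus x) &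
          forall i, exists2 X, X != 0 &
            forall Y, curv_eigenspace F x (col i (nus x)) Y
                      <-> exists a : R, Y = a *: X].

Definition Nv_perp F x : set 'cV[R]_N :=
  normal F x `&` orth (curvature_normal F x).

Definition principal F x X : Prop :=
  X != 0 /\ exists2 nu, curvature_normal F x nu & curv_eigenspace F x nu X.

(* The map F(x) |-> F'(x), i.e. the identity of the common parameter domain,
   is a Combescure transform. *)
Definition combescure F F' U : Prop :=
  [/\ immersion F U /\ flat_bundle U (normal F),
      immersion F' U /\ flat_bundle U (normal F') &
      forall x X, U x -> principal F x X ->
        principal F' x X /\
        exists2 a : R, a != 0 & jac F' x *m X = a *: (jac F x *m X)].

End Immersions.

Definition lie {A : pzRingType} {N : nat} (X Y : 'M[A]_N) : 'M[A]_N :=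
  X *m Y - Y *m X.

Section Killing.
Context {R : realType} {N : nat}.

Definition skew_defect (X : 'M[R]_N) : 'M[R]_N :=
  X^T *m lorentz R N + lorentz R N *m X.

Lemma skew_defect_is_linear : linear skew_defect.
Proof.
move=> a X Y; rewrite /skew_defect linearP mulmxDl mulmxDr -scalemxAl.
by rewrite -scalemxAr scalerDr addrACA.
Qed.

HB.instance Definition _ :=
  GRing.isLinear.Build R 'M[R]_N 'M[R]_N _ skew_defect skew_defect_is_linear.

Definition oLie : {vspace 'M[R]_N} := lker (linfun skew_defect).

Lemma mem_oLie (X : 'M[R]_N) :
  (X \in oLie) = (X^T *m lorentz R N + lorentz R N *m X == 0).
Proof. by rewrite memv_ker lfunE. Qed.

(* trace of ad X o ad Y on o(N-1,1) *)
Definition killing (X Y : 'M[R]_N) : R :=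
  \sum_(i < \dim oLie) coord (vbasis oLie) i (lie X (lie Y (vbasis oLie)`_i)).

End Killing.

Section System.
Context {R : realType} {n k : nat}.
Local Notation N := (n + (n + k))%N.

(* elementary matrix e_{ij}, with indices starting from 0 *)
Definition emx (i j : nat) : 'M[R]_N :=
  \matrix_(r, s) ((r == i :> nat) && (s == j :> nat))%:R.

Definition a_plus (i : 'I_n) : 'M[R]_N := emx i (n + i) - emx (n + i) i.

Definition eps (i : 'I_n) : R := if i.+1 == n then -1 else 1.

Definition a_minus (i : 'I_n) : 'M[R]_N :=
  emx i (n + k + i) - eps i *: emx (n + k + i) i.

Definition in_p (X : 'M[R]_N) : Prop :=
  exists xi : 'M[R]_(n, n + k),
    X = block_mx 0 xi (- (lorentz R (n + k) *m xi^T)) 0.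

Definition in_a_perp (c : 'I_n -> 'M[R]_N) (X : 'M[R]_N) : Prop :=
  forall a, a \in <<codom c>>%VS -> killing a X = 0.

Definition system_solution (c : 'I_n -> 'M[R]_N) (Xi : 'cV[R]_n -> 'M[R]_N) :
    Prop :=
  [/\ smooth_on setT Xi,
      forall x, in_a_perp c (Xi x) /\ in_p (Xi x) &
      forall x i j, i != j ->
        lie (c i) (pdmx j Xi x) - lie (c j) (pdmx i Xi x)
        - lie (lie (c i) (Xi x)) (lie (c j) (Xi x)) = 0].

(* dx_i-component of the Lax pair *)
Definition lax (c : 'I_n -> 'M[R]_N) (Xi : 'cV[R]_n -> 'M[R]_N)
    (lam : R[i]) (i : 'I_n) (x : 'cV[R]_n) : 'M[R[i]]_N :=
  lam *: toC (c i) + toC (lie (c i) (Xi x)).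

Definition rho : 'M[R[i]]_N := block_mx 1%:M 0 0 (- 1%:M).

Definition tau (g : 'M[R[i]]_N) : 'M[R[i]]_N := rho *m g *m invmx rho.

Definition extended_flat_frame (c : 'I_n -> 'M[R]_N)
    (Xi : 'cV[R]_n -> 'M[R]_N) (Phi : 'cV[R]_n -> R[i] -> 'M[R[i]]_N) : Prop :=
  [/\ forall lam, Csmooth (Phi ^~ lam),
      forall x lam, (Phi x lam)^T *m lorentz R[i] N *m Phi x lam = lorentz R[i] N,
      forall x lam i,
        invmx (Phi x lam) *m Cpdmx i (Phi ^~ lam) x = lax c Xi lam i x,
      forall x lam, map_mx conjc (Phi x lam) = Phi x (conjc lam) &
      forall x lam, tau (Phi x lam) = Phi x (- lam)].

End System.

(* Main.v *)
Require Import Defs.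
From HB Require Import structures.
From mathcomp Require Import all_boot all_order all_algebra.
From mathcomp Require Import all_classical all_reals all_analysis.
From mathcomp Require Import complex.
From mathcomp Require Import ring.
Set Implicit Arguments.
Unset Strict Implicit.
Unset Printing Implicit Defensive.
Import Order.TTheory GRing.Theory Num.Theory.
Import numFieldNormedType.Exports.
Local Open Scope classical_set_scope.
Local Open Scope ring_scope.

(** Write A for the frame at spectral parameter 1 and diag(g1, g2) for the frame
    at 0; the latter is block diagonal because tau fixes it, and both are real.
    The generator c_i has upper right block E_i, the elementary matrix at
    (i, s i), and the bracket of c_i and Xi is block diagonal, with blocks u_i and
    w_i; thus dg1 = g1 u and dg2 = g2 w, while the logarithmic derivative of A
    is the sum of c_i and diag(u_i, w_i). Put h = g2^-1 b, so that
    F = A (0; h). The two contributions of w_i to the derivative of F cancel: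
    d_i F is h_(s i) times the i-th column of A. Hence F is an immersion
    exactly where no h_(s i) vanishes, its tangent bundle is then spanned by
    the first n columns of A (the tangent frame) and its normal bundle by the
    others (the normal frame N).

    - The metric is diag(h_(s i)^2) = P^T P with P = g1 diag(h_(s i)). As c_i
      and c_j commute, the Jacobi identity makes d_i P_j symmetric in i and j,
      so the rows of P are closed forms and the metric is flat
      ([flat_metric_coframe], [frame_flat_metric]).
    - N g2^-1 is a frame of the normal bundle with constant Gram matrix and
      tangential derivatives; the normal bundle is flat
      ([flat_bundle_parallel], [frame_normal_flat]), by the symmetry of second
      derivatives ([pdC]).
    - The tangential part of d_i (N y) is y_(s i) times the i-th column of A,
      so all shape operators are diagonal in the tangent frame, with
      eigenvalues - y_(s i) / h_(s i). This gives n distinct curvature normals,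
      with the coordinate directions as eigenspaces
      ([frame_uniform_multiplicity_one]).
    - The curvature normals span the coordinates s i of the normal frame. The
      remaining columns of N have constant Gram matrix and are parallel, as the
      entries of w_i outside these coordinates vanish ([frame_Nv_perp_flat]).
    - The tangent frame and the principal directions do not depend on b, which
      gives the Combescure transforms ([frame_combescure]). *)

(** * Smooth functions *)

Section SmoothFunctions.
Context {R : realType} {n : nat}.
Implicit Types (U V : set 'cV[R]_n) (f g : 'cV[R]_n -> R) (x : 'cV[R]_n).

Lemma open_near_eq (T : Type) U (f g : 'cV[R]_n -> T) x :
  open U -> U x -> (forall y, U y -> f y = g y) -> {near x, f =1 g}.
Proof.
move=> oU Ux fg; have := open_nbhs_nbhs (conj oU Ux).
by apply: filterS => y /fg.
Qed.

Lemma eq_pd U f g i x : open U -> U x -> (forall y, U y -> f y = g y) ->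
  pd i f x = pd i g x.
Proof. by move=> oU Ux fg; apply: near_eq_derive; exact: open_near_eq fg. Qed.

Lemma Cl_on_eq l U f g : open U -> (forall x, U x -> f x = g x) ->
  Cl_on l U f -> Cl_on l U g.
Proof.
move=> oU; elim: l f g => [|l IH] f g fg /=.
  move=> cf x Ux; change (g @ x --> g x); rewrite -(fg x Ux).
  apply: cvg_trans (cf x Ux); apply: (@near_eq_cvg _ _ (nbhs x)).
  exact: open_near_eq fg.
move=> [df cf]; split=> [x i Ux|i].
  by apply: near_eq_derivable (df x i Ux); exact: open_near_eq fg.
by apply: IH (cf i) => x Ux; exact: eq_pd fg.
Qed.

Lemma Cl_on_sub l U V f : V `<=` U -> Cl_on l U f -> Cl_on l V f.
Proof.
move=> VU; elim: l f => [|l IH] f /= => [cf x /VU|[df cf]]; first exact: cf.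
by split=> [x i /VU|i]; [exact: df|exact: IH].
Qed.

(** Being C^l together with all lower orders; unlike [Cl_on l], whose
    clauses for l > 0 do not list the continuity of the function itself, this
    class is closed under products. *)
Definition Cle_on l U f := forall m, (m <= l)%N -> Cl_on m U f.

Lemma Cle_on_le l m U f : (m <= l)%N -> Cle_on l U f -> Cle_on m U f.
Proof. by move=> ml cf j /leq_trans/(_ ml); exact: cf. Qed.

Lemma Cle_on_pd l U f i : Cle_on l.+1 U f -> Cle_on l U (pd i f).
Proof. move=> cf m ml; exact: (cf m.+1 ml).2. Qed.

Lemma Cle_onS l U f : Cl_on 0 U f ->
  (forall x i, U x -> derivable f x (delta_mx i 0)) ->
  (forall i, Cle_on l U (pd i f)) -> Cle_on l.+1 U f.
Proof. by move=> c0 df dc [//|m] ml; split=> // i; exact: dc. Qed.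

Lemma Cle_on_eq l U f g : open U -> (forall x, U x -> f x = g x) ->
  Cle_on l U f -> Cle_on l U g.
Proof. by move=> oU fg cf m ml; apply: Cl_on_eq fg _ => //; exact: cf. Qed.

Lemma Cle_on_derivable l U f x i : Cle_on l.+1 U f -> U x ->
  derivable f x (delta_mx i 0).
Proof. by move=> cf; have [df _] := cf 1%N isT; exact: df. Qed.

Lemma pdD f g x i : derivable f x (delta_mx i 0) ->
  derivable g x (delta_mx i 0) ->
  pd i (fun y => f y + g y) x = pd i f x + pd i g x.
Proof. exact: deriveD. Qed.

Lemma pdM f g x i : derivable f x (delta_mx i 0) ->
  derivable g x (delta_mx i 0) ->
  pd i (fun y => f y * g y) x = pd i f x * g x + f x * pd i g x.
Proof.
by move=> df dg; rewrite /pd [LHS](deriveM df dg) addrC [X in X + _]mulrC.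
Qed.

Lemma pd_cst (a : R) x i : pd i (fun=> a) x = 0.
Proof. exact: derive_cst. Qed.

Lemma Cle_on_cst l U (a : R) : Cle_on l U (fun=> a).
Proof.
elim: l a => [|l IH] a.
  by move=> [|m] //= _ x _; exact: cst_continuous.
apply: Cle_onS => [x _|x i _|i]; first exact: cst_continuous.
  exact: derivable_cst.
by have -> : pd i (fun=> a) = fun=> 0 by apply/funext => x; exact: pd_cst.
Qed.

Lemma Cle_onD l U f g : open U -> Cle_on l U f -> Cle_on l U g ->
  Cle_on l U (fun x => f x + g x).
Proof.
move=> oU; elim: l f g => [|l IH] f g cf cg.
  move=> [|m] //= _ x Ux; apply: continuousD.
    exact: (cf 0%N isT x Ux).
  exact: (cg 0%N isT x Ux).
apply: Cle_onS => [x Ux|x i Ux|i].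
- by apply: continuousD; [exact: (cf 0%N isT x Ux)|exact: (cg 0%N isT x Ux)].
- apply: derivableD; first exact: Cle_on_derivable cf _.
  exact: Cle_on_derivable cg _.
apply: (@Cle_on_eq _ _ (fun x => pd i f x + pd i g x)) => // [x Ux|].
  by rewrite pdD//; [exact: Cle_on_derivable cf _|exact: Cle_on_derivable cg _].
by apply: IH; exact: Cle_on_pd.
Qed.

Lemma Cle_onM l U f g : open U -> Cle_on l U f -> Cle_on l U g ->
  Cle_on l U (fun x => f x * g x).
Proof.
move=> oU; elim: l f g => [|l IH] f g cf cg.
  move=> [|m] //= _ x Ux; apply: continuousM.
    exact: (cf 0%N isT x Ux).
  exact: (cg 0%N isT x Ux).
apply: Cle_onS => [x Ux|x i Ux|i].
- by apply: continuousM; [exact: (cf 0%N isT x Ux)|exact: (cg 0%N isT x Ux)].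
- apply: derivableM; first exact: Cle_on_derivable cf _.
  exact: Cle_on_derivable cg _.
apply: (@Cle_on_eq _ _ (fun x => pd i f x * g x + f x * pd i g x)) => // [x Ux|].
  by rewrite pdM//; [exact: Cle_on_derivable cf _|exact: Cle_on_derivable cg _].
by apply: Cle_onD => //; apply: IH;
  by [exact: Cle_on_pd|exact: Cle_on_le (leqnSn l) _].
Qed.

Lemma Cle_onV l U f : open U -> (forall x, U x -> f x != 0) -> Cle_on l U f ->
  Cle_on l U (fun x => (f x)^-1).
Proof.
move=> oU f0; elim: l => [|l IH] cf.
  move=> [|m] //= _ x Ux; apply: continuousV; first exact: f0.
  exact: (cf 0%N isT x Ux).
apply: Cle_onS => [x Ux|x i Ux|i].
- by apply: continuousV; [exact: f0|exact: (cf 0%N isT x Ux)].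
- by apply: derivableV; [exact: f0|exact: Cle_on_derivable cf _].
apply: (@Cle_on_eq _ _ (fun x => -1 * pd i f x * ((f x)^-1 * (f x)^-1))) => //.
  move=> x Ux; rewrite /pd deriveV; [|exact: f0|exact: Cle_on_derivable cf _].
  by rewrite -exprVn expr2 mulN1r mulNr mulrC scaleNr.
have cV : Cle_on l U (fun x => (f x)^-1) by exact/IH/Cle_on_le/cf.
apply: (Cle_onM oU _ (Cle_onM oU cV cV)).
apply: (@Cle_onM l U (fun=> -1) (pd i f)) => //; first exact: Cle_on_cst.
exact: Cle_on_pd.
Qed.

(** Real-valued smooth functions. *)
Definition smooth U f := forall l, Cl_on l U f.

Lemma smoothP U f : smooth U f <-> forall l, Cle_on l U f.
Proof. by split=> [cf l m _|cf l]; [exact: cf|exact: (cf l)]. Qed.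

Lemma smooth_cst U (a : R) : smooth U (fun=> a).
Proof. by apply/smoothP => l; exact: Cle_on_cst. Qed.

Lemma smoothD U f g : open U -> smooth U f -> smooth U g ->
  smooth U (fun x => f x + g x).
Proof.
by move=> oU /smoothP cf /smoothP cg; apply/smoothP => l; exact: Cle_onD.
Qed.

Lemma smoothM U f g : open U -> smooth U f -> smooth U g ->
  smooth U (fun x => f x * g x).
Proof.
by move=> oU /smoothP cf /smoothP cg; apply/smoothP => l; exact: Cle_onM.
Qed.

Lemma smoothV U f : open U -> (forall x, U x -> f x != 0) -> smooth U f ->
  smooth U (fun x => (f x)^-1).
Proof.
by move=> oU f0 /smoothP cf; apply/smoothP => l; exact: Cle_onV.
Qed.

Lemma smooth_sum (I : Type) (r : seq I) U (f : I -> 'cV[R]_n -> R) :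
  open U -> (forall i, smooth U (f i)) -> smooth U (fun x => \sum_(i <- r) f i x).
Proof.
move=> oU cf; elim: r => [|i r IH].
  have -> : (fun x => \sum_(i <- [::]) f i x) = fun=> 0.
    by apply/funext => x; rewrite big_nil.
  exact: smooth_cst.
have -> : (fun x => \sum_(j <- i :: r) f j x) =
    fun x => f i x + \sum_(j <- r) f j x.
  by apply/funext => x; rewrite big_cons.
exact: smoothD.
Qed.

Lemma smooth_pd U f i : smooth U f -> smooth U (pd i f).
Proof. move=> cf l; exact: (cf l.+1).2. Qed.

Lemma smooth_derivable U f x i : smooth U f -> U x ->
  derivable f x (delta_mx i 0).
Proof. by move=> cf; have [df _] := cf 1%N; exact: df. Qed.

Lemma smooth_continuous U f x : smooth U f -> U x -> {for x, continuous f}.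
Proof. by move=> cf Ux; exact: (cf 0%N x Ux). Qed.

Lemma smooth_eq U f g : open U -> (forall x, U x -> f x = g x) ->
  smooth U f -> smooth U g.
Proof. by move=> oU fg cf l; exact: Cl_on_eq fg _. Qed.

Lemma pd_sum (I : Type) (r : seq I) U (f : I -> 'cV[R]_n -> R) i x :
  open U -> U x -> (forall j, smooth U (f j)) ->
  pd i (fun y => \sum_(j <- r) f j y) x = \sum_(j <- r) pd i (f j) x.
Proof.
move=> oU Ux cf; elim: r => [|j r IH].
  rewrite big_nil -[RHS](pd_cst 0 x i); congr (pd i _ x).
  by apply/funext => y; rewrite big_nil.
have -> : (fun x => \sum_(j <- j :: r) f j x) =
    fun x => f j x + \sum_(j <- r) f j x.
  by apply/funext => y; rewrite big_cons.
rewrite big_cons pdD ?IH //; first exact: smooth_derivable (cf j) Ux.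
by apply: smooth_derivable Ux; exact: smooth_sum.
Qed.

End SmoothFunctions.

(** * Symmetry of second derivatives *)

Section MixedDerivatives.
Context {R : realType} {V : normedModType R}.
Implicit Types (f : V -> R) (x u v : V) (P U : set V).

Lemma is_derive_line f a u (t : R) : derivable f (a + t *: u) u ->
  is_derive t 1 (fun s : R => f (a + s *: u)) ('D_u f (a + t *: u)).
Proof.
have E : (fun h : R => h^-1 *: (((fun s : R => f (a + s *: u)) \o shift t) (h *: 1)
      - f (a + t *: u))) =
    (fun h : R => h^-1 *: ((f \o shift (a + t *: u)) (h *: u) - f (a + t *: u))).
  apply/funext => h /=; congr (_ *: (f _ - _)).
  by rewrite scalerDl [h *: 1]mulr1 addrCA.
by move=> df; split; rewrite /derivable /derive E.
Qed.

Lemma nbhs_parallelogram x u v P : nbhs x P ->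
  exists2 h : R, 0 < h & forall s t, 0 <= s <= h -> 0 <= t <= h ->
    P (x + s *: u + t *: v).
Proof.
move=> /nbhs_ballP[e /= e0 eP].
have d0 : 0 < `|u| + `|v| + 1 by rewrite ltr_wpDl// addr_ge0.
exists (e / (`|u| + `|v| + 1)); first exact: divr_gt0.
set h := e / _ => s t /andP[s0 sh] /andP[t0 th]; apply: eP.
rewrite -ball_normE /= -addrA opprD addrA subrr sub0r normrN.
apply: (@le_lt_trans _ _ (h * (`|u| + `|v|))).
  rewrite (le_trans (ler_normD _ _))// !normrZ !ger0_norm// mulrDr.
  by apply: lerD; apply: ler_wpM2r.
by rewrite /h -mulrA gtr_pMr// mulrC ltr_pdivrMr// mul1r ltrDl.
Qed.

(** Two applications of the mean value theorem. *)
Lemma second_difference f x u v (h : R) U : 0 < h ->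
  (forall s t, 0 <= s <= h -> 0 <= t <= h -> U (x + s *: u + t *: v)) ->
  (forall y, U y -> derivable f y u) ->
  (forall y, U y -> derivable ('D_u f) y v) ->
  exists s t : R, [/\ 0 <= s <= h, 0 <= t <= h &
    f (x + h *: u + h *: v) - f (x + h *: u) - (f (x + h *: v) - f x) =
    h * h * 'D_v ('D_u f) (x + s *: u + t *: v)].
Proof.
move=> h0 hU du dv.
have h00 : 0 <= (0 : R) <= h by rewrite lexx ltW.
have hh : 0 <= h <= h by rewrite lexx ltW.
have D1 t : 0 <= t <= h -> is_derive t 1
    (fun s : R => f (x + h *: v + s *: u) - f (x + s *: u))
    ('D_u f (x + h *: v + t *: u) - 'D_u f (x + t *: u)).
  move=> th; apply: is_deriveB; apply: is_derive_line; apply: du.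
    by rewrite addrAC; exact: hU.
  by rewrite -[X in U X]addr0 -(scale0r v); exact: hU.
have I1 t : t \in `]0, h[ -> 0 <= t <= h by move=> /andP[/= /ltW -> /ltW ->].
have [|s /I1 sh E1] := MVT h0 (fun t th => D1 t (I1 t th)).
  by apply: derivable_within_continuous => t /D1[].
have D2 t : 0 <= t <= h -> is_derive t 1
    (fun r : R => 'D_u f (x + s *: u + r *: v))
    ('D_v ('D_u f) (x + s *: u + t *: v)).
  by move=> th; apply: is_derive_line; apply: dv; exact: hU.
have [|t /I1 th E2] := MVT h0 (fun t th => D2 t (I1 t th)).
  by apply: derivable_within_continuous => r /D2[].
exists s, t; split=> //.
move: E1 E2; rewrite !subr0 !scale0r !addr0 => E1 E2.
by rewrite [x + h *: u + _]addrAC E1 [x + h *: v + _]addrAC E2 -mulrA mulrC.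
Qed.

(** Symmetry of second derivatives: both mixed derivatives are limits of the
    same second difference quotient. *)
Lemma derive_comm f x u v U : nbhs x U ->
  (forall y, U y -> derivable f y u) -> (forall y, U y -> derivable f y v) ->
  (forall y, U y -> derivable ('D_u f) y v) ->
  (forall y, U y -> derivable ('D_v f) y u) ->
  {for x, continuous ('D_v ('D_u f))} -> {for x, continuous ('D_u ('D_v f))} ->
  'D_v ('D_u f) x = 'D_u ('D_v f) x.
Proof.
move=> Ux fu fv fuv fvu cuv cvu; apply/eqP; rewrite -subr_eq0 -normr_eq0.
rewrite eq_le normr_ge0 andbT; apply/ler_addgt0Pl => e e0; rewrite addr0.
have e20 : 0 < e / 2 by rewrite divr_gt0.
have /cvgrPdist_lt/(_ _ e20) c1 := cuv.
have /cvgrPdist_lt/(_ _ e20) c2 := cvu.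
have [h h0 hP] := nbhs_parallelogram u v (filterI Ux (filterI c1 c2)).
have [||//|s [t [sh th E1]]] := @second_difference f x u v h U h0.
- by move=> s t sh th; have [] := hP s t sh th.
- exact: fu.
have [||//|t' [s' [th' sh' E2]]] := @second_difference f x v u h U h0.
- by move=> t' s' th' sh'; rewrite addrAC; have [] := hP s' t' sh' th'.
- exact: fv.
(* The two orders give the same second difference. *)
have E : 'D_v ('D_u f) (x + s *: u + t *: v) =
    'D_u ('D_v f) (x + s' *: u + t' *: v).
  apply: (@mulfI _ (h * h)); first by rewrite mulf_neq0// gt_eqF.
  move: E2; rewrite (addrAC x (h *: v)) (addrAC x (t' *: v)) => E2.
  apply: (etrans (esym E1)); apply: (etrans _ E2).
  move: (f _) (f _) (f _) (f _) => p q r w.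
  by rewrite !opprB addrACA [RHS]addrACA [- q - r]addrC.
have [_ [/= d1 _]] := hP s t sh th; have [_ [/= _ d2]] := hP s' t' sh' th'.
rewrite -E in d2.
rewrite -(subrKA ('D_v ('D_u f) (x + s *: u + t *: v))).
apply: (le_trans (ler_normD _ _)); rewrite [leRHS]splitr; apply: lerD.
  exact: ltW d1.
by rewrite distrC; exact: ltW d2.
Qed.

End MixedDerivatives.

(** Schwarz's theorem for smooth functions. *)
Lemma pdC {R : realType} {n : nat} (U : set 'cV[R]_n) (f : 'cV[R]_n -> R) i j x :
  open U -> U x -> smooth U f -> pd i (pd j f) x = pd j (pd i f) x.
Proof.
move=> oU Ux cf; apply: (@derive_comm _ _ f x _ _ U).
- exact: open_nbhs_nbhs (conj oU Ux).
- by move=> y; exact: smooth_derivable.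
- by move=> y; exact: smooth_derivable.
- by move=> y; apply: smooth_derivable; exact: smooth_pd.
- by move=> y; apply: smooth_derivable; exact: smooth_pd.
- by apply: smooth_continuous Ux; exact/smooth_pd/smooth_pd.
- by apply: smooth_continuous Ux; exact/smooth_pd/smooth_pd.
Qed.

(** * Smooth matrices and parallel frames *)

Section SmoothMatrices.
Context {R : realType} {n : nat}.
Implicit Types (U V : set 'cV[R]_n) (x : 'cV[R]_n) (i j : 'I_n).

Lemma smooth_on_cst p q U (M : 'M[R]_(p, q)) :
  smooth_on U (fun _ : 'cV[R]_n => M).
Proof. by move=> a b; exact: smooth_cst. Qed.

Lemma smooth_on_eq p q U (f g : 'cV[R]_n -> 'M[R]_(p, q)) : open U ->
  (forall x, U x -> f x = g x) -> smooth_on U f -> smooth_on U g.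
Proof.
by move=> oU fg cf a b; apply: (smooth_eq oU _ (cf a b)) => x /fg ->.
Qed.

Lemma smooth_on_sub p q U V (f : 'cV[R]_n -> 'M[R]_(p, q)) : V `<=` U ->
  smooth_on U f -> smooth_on V f.
Proof. by move=> VU cf a b l; exact/(Cl_on_sub VU)/cf. Qed.

Lemma smooth_on_setT p q {U} (f : 'cV[R]_n -> 'M[R]_(p, q)) :
  smooth_on setT f -> smooth_on U f.
Proof. by apply: smooth_on_sub. Qed.

Lemma smooth_onM p q r U (f : 'cV[R]_n -> 'M[R]_(p, q))
    (g : 'cV[R]_n -> 'M[R]_(q, r)) : open U ->
  smooth_on U f -> smooth_on U g -> smooth_on U (fun x => f x *m g x).
Proof.
move=> oU cf cg a b.
have -> : (fun x => (f x *m g x) a b) = fun x => \sum_c f x a c * g x c b.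
  by apply/funext => x; rewrite mxE.
apply: (@smooth_sum _ _ _ _ U (fun c x => f x a c * g x c b)) => // c.
exact: (smoothM oU (cf a c) (cg c b)).
Qed.

Lemma smooth_on_tr p q U (f : 'cV[R]_n -> 'M[R]_(p, q)) :
  smooth_on U f -> smooth_on U (fun x => (f x)^T).
Proof.
move=> cf a b.
have -> : (fun x => (f x)^T a b) = fun x => f x b a.
  by apply/funext => x; rewrite mxE.
exact: cf.
Qed.

Lemma smooth_on_pdmx p q U (f : 'cV[R]_n -> 'M[R]_(p, q)) i :
  smooth_on U f -> smooth_on U (pdmx i f).
Proof.
move=> cf a b.
have -> : (fun x => pdmx i f x a b) = pd i (fun y => f y a b).
  by apply/funext => x; rewrite mxE.
by apply: smooth_pd; exact: cf.
Qed.

Lemma smooth_on_mxsub p q p' q' U (f : 'cV[R]_n -> 'M[R]_(p, q))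
    (phi : 'I_p' -> 'I_p) (psi : 'I_q' -> 'I_q) :
  smooth_on U f -> smooth_on U (fun x => mxsub phi psi (f x)).
Proof.
move=> cf a b.
have -> : (fun x => mxsub phi psi (f x) a b) = fun x => f x (phi a) (psi b).
  by apply/funext => x; rewrite mxE.
exact: cf.
Qed.

Lemma smooth_on_diag p U (d : 'cV[R]_n -> 'I_p -> R) :
  (forall a, smooth U (fun x => d x a)) ->
  smooth_on U (fun x => diag_mx (\row_a d x a)).
Proof.
move=> cd a b.
have [ab|ab] := eqVneq a b.
  have -> : (fun x => diag_mx (\row_a d x a) a b) = fun x => d x b.
    by apply/funext => x; rewrite !mxE ab eqxx.
  exact: cd.
have -> : (fun x => diag_mx (\row_a d x a) a b) = fun=> 0.
  by apply/funext => x; rewrite !mxE (negPf ab).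
exact: smooth_cst.
Qed.

Lemma eq_pdmx p q U (f g : 'cV[R]_n -> 'M[R]_(p, q)) i x : open U -> U x ->
  (forall y, U y -> f y = g y) -> pdmx i f x = pdmx i g x.
Proof.
move=> oU Ux fg; apply/matrixP => a b; rewrite !mxE.
by apply: (eq_pd i oU Ux) => y /fg ->.
Qed.

Lemma pdmx_cst p q (M : 'M[R]_(p, q)) i x : pdmx i (fun=> M) x = 0.
Proof. by apply/matrixP => a b; rewrite !mxE pd_cst. Qed.

Lemma pdmx_tr p q (f : 'cV[R]_n -> 'M[R]_(p, q)) i x :
  pdmx i (fun y => (f y)^T) x = (pdmx i f x)^T.
Proof.
apply/matrixP => a b; rewrite !mxE; congr (pd i _ x).
by apply/funext => y; rewrite mxE.
Qed.

Lemma pdmx_mxsub p q p' q' (f : 'cV[R]_n -> 'M[R]_(p, q))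
    (phi : 'I_p' -> 'I_p) (psi : 'I_q' -> 'I_q) i x :
  pdmx i (fun y => mxsub phi psi (f y)) x = mxsub phi psi (pdmx i f x).
Proof.
apply/matrixP => a b; rewrite !mxE; congr (pd i _ x).
by apply/funext => y; rewrite mxE.
Qed.

Lemma pdmxM p q r U (f : 'cV[R]_n -> 'M[R]_(p, q))
    (g : 'cV[R]_n -> 'M[R]_(q, r)) i x : open U -> U x ->
  smooth_on U f -> smooth_on U g ->
  pdmx i (fun y => f y *m g y) x = pdmx i f x *m g x + f x *m pdmx i g x.
Proof.
move=> oU Ux cf cg; apply/matrixP => a b; rewrite !mxE.
have -> : (fun y => (f y *m g y) a b) = fun y => \sum_c f y a c * g y c b.
  by apply/funext => y; rewrite mxE.
rewrite (@pd_sum _ _ _ _ U (fun c y => f y a c * g y c b)) // => [|c].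
  rewrite -big_split; apply: eq_bigr => c _; rewrite /= !mxE.
  by rewrite pdM//; exact: smooth_derivable Ux.
exact: (smoothM oU (cf a c) (cg c b)).
Qed.

Lemma pdmxMl p q r U (M : 'M[R]_(p, q)) (g : 'cV[R]_n -> 'M[R]_(q, r)) i x :
  open U -> U x -> smooth_on U g ->
  pdmx i (fun y => M *m g y) x = M *m pdmx i g x.
Proof.
move=> oU Ux cg; rewrite (@pdmxM _ _ _ U (fun=> M))//; last exact: smooth_on_cst.
by rewrite pdmx_cst mul0mx add0r.
Qed.

Lemma pdmxMr p q r U (f : 'cV[R]_n -> 'M[R]_(p, q)) (M : 'M[R]_(q, r)) i x :
  open U -> U x -> smooth_on U f ->
  pdmx i (fun y => f y *m M) x = pdmx i f x *m M.
Proof.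
move=> oU Ux cf; rewrite (@pdmxM _ _ _ U f (fun=> M))//; last exact: smooth_on_cst.
by rewrite pdmx_cst mulmx0 addr0.
Qed.

Lemma pdmxC p q U (f : 'cV[R]_n -> 'M[R]_(p, q)) i j x :
  open U -> U x -> smooth_on U f ->
  pdmx i (pdmx j f) x = pdmx j (pdmx i f) x.
Proof.
move=> oU Ux cf; apply/matrixP => a b.
have E l m : pdmx l (pdmx m f) x a b = pd l (pd m (fun y => f y a b)) x.
  by rewrite mxE; congr (pd l _ x); apply/funext => y; rewrite mxE.
apply: (etrans (E i j)); apply: (etrans _ (esym (E j i))).
have sab : smooth U (fun y => f y a b) by exact: (cf a b).
exact: (pdC i j oU Ux sab).
Qed.

Lemma col_jac p (F : 'cV[R]_n -> 'cV[R]_p) i x : col i (jac F x) = pdmx i F x.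
Proof. by apply/matrixP => a b; rewrite !mxE (ord1 b). Qed.

End SmoothMatrices.

Section LorentzFrames.
Context {R : realType}.

Lemma tr_lorentz N : (lorentz R N)^T = lorentz R N.
Proof.
by apply/matrixP => i j; rewrite !mxE eq_sym; case: eqVneq => // ->.
Qed.

Lemma lorentzE N : lorentz R N = diag_mx (\row_i (if i.+1 == N then -1 else 1)).
Proof.
apply/matrixP => i j; rewrite !mxE.
by case: eqVneq => [->|]; rewrite ?mulr1n ?mulr0n.
Qed.

Lemma lorentzK N : lorentz R N *m lorentz R N = 1%:M.
Proof.
rewrite {2}lorentzE mul_mx_diag; apply/matrixP => i j; rewrite !mxE.
case: eqVneq => [->|_]; last by rewrite mul0r.
by case: ifP => _; rewrite ?mulrNN mulr1.
Qed.

Context {N r : nat}.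
Local Notation L := (lorentz R N).
Implicit Types (B : set 'cV[R]_N) (T : 'M[R]_(N, r)) (G : 'M[R]_r).

Lemma ip_sym (u v : 'cV[R]_N) : ip u v = ip v u.
Proof.
rewrite /ip.
have -> : u^T *m L *m v = (v^T *m L *m u)^T.
  by rewrite !trmx_mul trmxK tr_lorentz mulmxA.
by rewrite [LHS]mxE.
Qed.

(** [B] is the column space of [T]. *)
Definition spans T B := forall u, B u <-> exists a : 'cV[R]_r, u = T *m a.

Lemma orth_spans T B u : spans T B -> orth B u <-> T^T *m L *m u = 0.
Proof.
move=> TB.
have E a : ip u (T *m a) = (a^T *m (T^T *m L *m u)) 0 0.
  by rewrite ip_sym /ip trmx_mul !mulmxA.
split=> [uB|Tu b /TB[a ->]]; last by rewrite E Tu mulmx0 mxE.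
apply/colP => i; rewrite [RHS]mxE.
have := uB (T *m delta_mx i 0) ((TB _).2 (ex_intro _ _ erefl)).
by rewrite E trmx_delta -rowE mxE.
Qed.

Lemma oproj_spans T G B u : T^T *m L *m T = G -> G \in unitmx -> spans T B ->
  oproj B u = T *m (invmx G *m (T^T *m L *m u)).
Proof.
move=> TG uG TB; apply: xget_unique => [/=|t [/TB[a ->] /(orth_spans _ TB)]].
  split; first by apply/TB; eexists.
  apply/(orth_spans _ TB); rewrite mulmxBr mulmxA TG mulmxA mulmxV// mul1mx.
  by rewrite subrr.
rewrite mulmxBr mulmxA TG => /eqP; rewrite subr_eq0 => /eqP ->.
by rewrite mulKmx.
Qed.

Lemma nondegenerate_spans T G B : T^T *m L *m T = G -> G \in unitmx ->
  spans T B -> Defs.nondegenerate B.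
Proof.
move=> TG uG TB u /TB[a ->] /(orth_spans _ TB); rewrite mulmxA TG => Ga.
by rewrite -(mulKmx uG a) Ga !mulmx0.
Qed.

Lemma rank_spans T G : T^T *m L *m T = G -> G \in unitmx -> \rank T = r.
Proof.
move=> TG uG; apply/eqP; rewrite eqn_leq rank_leq_col /=.
by rewrite -[X in (X <= _)%N](mxrank_unit uG) -TG mxrankM_maxr.
Qed.

End LorentzFrames.

(** A bundle with a frame [T] of constant nondegenerate Gram matrix [G] that
    is parallel for the induced connection is flat: a section is [T *m z], its
    covariant derivatives are the [T *m pdmx i z], and the partial derivatives
    of [z] commute. *)
Lemma flat_bundle_parallel {R : realType} {n N r : nat} (U : set 'cV[R]_n)
    (B : 'cV[R]_n -> set 'cV[R]_N) (T : 'cV[R]_n -> 'M[R]_(N, r)) (G : 'M[R]_r) :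
  open U -> G \in unitmx -> smooth_on U T ->
  (forall x, U x -> (T x)^T *m lorentz R N *m T x = G) ->
  (forall x i, U x -> (T x)^T *m lorentz R N *m pdmx i T x = 0) ->
  (forall x, U x -> spans (T x) (B x)) ->
  flat_bundle U B.
Proof.
move=> oU uG sT TG dT TB; split.
- move=> x Ux; exists U; split=> //; exists r, T; split=> // y Uy.
  by split; [exact: rank_spans (TG y Uy) uG|exact: TB].
- by move=> x Ux; exact: nondegenerate_spans (TG x Ux) uG (TB x Ux).
move=> V s oV VU [ss sB] x i j Vx.
have sTV := smooth_on_sub VU sT.
pose P (y : 'cV[R]_n) := invmx G *m ((T y)^T *m lorentz R N).
have sP : smooth_on V P.
  apply: smooth_onM => //; first exact: smooth_on_cst.
  apply: smooth_onM => //; last exact: smooth_on_cst.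
  exact: smooth_on_tr.
(* The covariant derivative in coordinates with respect to the frame. *)
have nablaE (z : 'cV[R]_n -> 'cV[R]_r) (t : 'cV[R]_n -> 'cV[R]_N) l y :
    smooth_on V z -> (forall y, V y -> t y = T y *m z y) -> V y ->
    nabla B l t y = T y *m pdmx l z y.
  move=> sz tE Vy; have Uy := VU _ Vy.
  rewrite /nabla (oproj_spans _ (TG y Uy) uG (TB y Uy)) (eq_pdmx _ oV Vy tE).
  rewrite (pdmxM _ oV)//.
  have -> : (T y)^T *m lorentz R N *m (pdmx l T y *m z y + T y *m pdmx l z y) =
      G *m pdmx l z y.
    by rewrite mulmxDr !mulmxA dT// mul0mx add0r TG.
  by rewrite mulKmx.
have sz : smooth_on V (fun y => P y *m s y) by exact: smooth_onM.
have sE y : V y -> s y = T y *m (P y *m s y).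
  move=> Vy; have [a ->] := (TB y (VU _ Vy) _).1 (sB y Vy).
  by rewrite /P -mulmxA [_ *m (T y *m a)]mulmxA TG ?mulKmx//; exact: VU.
have n1 l y : V y -> nabla B l s y = T y *m pdmx l (fun y => P y *m s y) y.
  by move=> Vy; apply: nablaE.
rewrite (nablaE _ _ i x (smooth_on_pdmx j sz) (n1 j) Vx).
rewrite (nablaE _ _ j x (smooth_on_pdmx i sz) (n1 i) Vx).
by rewrite (pdmxC _ _ oV).
Qed.

(** * Flat metrics *)

Lemma invmx_eq {R : comUnitRingType} {n : nat} (A B : 'M[R]_n) :
  A *m B = 1%:M -> invmx A = B.
Proof.
by move=> AB; have [uA _] := mulmx1_unit AB; rewrite -[LHS]mulmx1 -AB mulKmx.
Qed.

(** Cancellation in the Koszul formula when dP is symmetric. *)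
Lemma koszul_sum (R : comPzRingType) (I : Type) (K : I -> I -> I -> R) :
  (forall i j l, K i l j = K j l i) -> forall i j l,
  K i j l + K i l j + (K j i l + K j l i) - (K l i j + K l j i) = 2 * K i l j.
Proof. move=> Ks i j l; rewrite (Ks j i l) (Ks l i j) (Ks l j i); ring. Qed.

(** If the rows of the invertible matrix [P] are closed one-forms, then
    [P^T P] is the pull-back of the Euclidean metric by a local diffeomorphism
    with Jacobian [P]. Its
    Christoffel symbols are the entries of [P^-1 dP], a pure gauge, whence the
    vanishing of its curvature. *)
Section FlatMetric.
Context {R : realType} {n : nat}.
Variables (U : set 'cV[R]_n) (P Q g : 'cV[R]_n -> 'M[R]_n).
Hypotheses (oU : open U) (sP : smooth_on U P) (sQ : smooth_on U Q).
Hypothesis QP : forall x, U x -> Q x *m P x = 1%:M.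
Hypothesis gE : forall x, U x -> g x = (P x)^T *m P x.
Hypothesis closedP :
  forall x i j, U x -> col j (pdmx i P x) = col i (pdmx j P x).

Let K i x : 'M[R]_n := (P x)^T *m pdmx i P x.

Let pd_metric i j l x : U x -> pd i (fun y => g y j l) x = K i x j l + K i x l j.
Proof.
move=> Ux.
have -> : pd i (fun y => g y j l) x = pdmx i g x j l by rewrite mxE.
rewrite (eq_pdmx i oU Ux gE) (pdmxM i oU Ux _ sP); last exact: smooth_on_tr.
rewrite pdmx_tr mxE addrC; congr (_ + _).
have -> : (pdmx i P x)^T *m P x = (K i x)^T by rewrite trmx_mul trmxK.
by rewrite mxE.
Qed.

Let K_sym i j l x : U x -> K i x l j = K j x l i.
Proof.
move=> Ux; have /(congr1 (fun v => ((P x)^T *m v) l 0)) := closedP i j Ux.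
by rewrite !colE !mulmxA -!colE [LHS]mxE [RHS]mxE.
Qed.

(* The Koszul formula: the derivatives of the metric combine to one term. *)
Let koszul i j l x : U x ->
  pd i (fun y => g y j l) x + pd j (fun y => g y i l) x
    - pd l (fun y => g y i j) x = 2 * K i x l j.
Proof.
move=> Ux; have E a b c := pd_metric a b c Ux.
apply: (etrans (congr2 (fun a b => a - b) (congr2 +%R (E i j l) (E j i l)) (E l i j))).
exact: (@koszul_sum _ _ (fun a b c => K a x b c) (fun a b c => K_sym a b c Ux)).
Qed.

Lemma christoffel_coframe m i j x : U x ->
  christoffel g m i j x = (Q x *m pdmx i P x) m j.
Proof.
move=> Ux; have PQ := mulmx1C (QP Ux).
have gV : invmx (g x) = Q x *m (Q x)^T.
  apply: invmx_eq; rewrite (gE Ux) mulmxA -(mulmxA _ (P x)) PQ mulmx1.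
  by rewrite -trmx_mul QP// trmx1.
have -> : Q x *m pdmx i P x = Q x *m (Q x)^T *m K i x.
  by rewrite /K mulmxA -(mulmxA (Q x)) -trmx_mul PQ trmx1 mulmx1.
rewrite /christoffel gV mxE mulr_sumr; apply: eq_bigr => l _.
apply: (etrans (congr1 (fun a => _ * (_ * a)) (koszul i j l Ux))).
by rewrite mulrCA; congr (_ * _); rewrite mulKf// pnatr_eq0.
Qed.

Let pdQ i x : U x -> pdmx i Q x = - (Q x *m pdmx i P x *m Q x).
Proof.
move=> Ux; have := eq_pdmx i oU Ux QP.
rewrite pdmx_cst (pdmxM i oU Ux sQ sP) => /eqP; rewrite addr_eq0 => /eqP E.
by rewrite -mulNmx -E -mulmxA (mulmx1C (QP Ux)) mulmx1.
Qed.

Let pd_christoffel i j m l x : U x -> pd i (christoffel g m j l) x =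
  (Q x *m pdmx i (pdmx j P) x - Q x *m pdmx i P x *m (Q x *m pdmx j P x)) m l.
Proof.
move=> Ux; apply: (etrans (eq_pd i oU Ux (christoffel_coframe m j l))).
have -> : pd i (fun y => (Q y *m pdmx j P y) m l) x =
    pdmx i (fun y => Q y *m pdmx j P y) x m l by rewrite mxE.
rewrite (pdmxM i oU Ux sQ (smooth_on_pdmx j sP)) pdQ// addrC.
by rewrite mulNmx -!mulmxA.
Qed.

Lemma flat_metric_coframe : flat_metric U g.
Proof.
move=> x Ux; split=> [X X0|m l i j].
  have PX0 : P x *m X != 0.
    by apply: contra_neq X0 => PX; rewrite -[X]mul1mx -(QP Ux) -mulmxA PX mulmx0.
  rewrite gE// mulmxA -trmx_mul -mulmxA mxE.
  have /cV0Pn[a Pa] := PX0.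
  rewrite (bigD1 a)//= mxE -expr2 ltr_pwDl ?exprn_even_gt0 ?Pa//.
  by apply: sumr_ge0 => b _; rewrite mxE -expr2 sqr_ge0.
rewrite /riemann !pd_christoffel//.
have -> : \sum_p (christoffel g m i p x * christoffel g p j l x -
      christoffel g m j p x * christoffel g p i l x) =
    (Q x *m pdmx i P x *m (Q x *m pdmx j P x) -
     Q x *m pdmx j P x *m (Q x *m pdmx i P x)) m l.
  rewrite mxE [X in X + _]mxE [X in _ + X]mxE [X in - X]mxE -sumrB.
  by apply: eq_bigr => p _; rewrite !christoffel_coframe.
have -> : pdmx i (pdmx j P) x = pdmx j (pdmx i P) x by exact: pdmxC oU Ux sP.
have cancel (M A B : 'M[R]_n) : (M - A) m l - (M - B) m l + (A - B) m l = 0.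
  by rewrite !mxE; ring.
exact: cancel.
Qed.

End FlatMetric.

(** * Geometry of an adapted frame *)

Lemma diag_mxVK {K : fieldType} {n : nat} (d : 'I_n -> K) :
  (forall i, d i != 0) ->
  diag_mx (\row_i (d i)^-1) *m diag_mx (\row_i d i) = 1%:M.
Proof.
move=> d0; rewrite mulmx_diag -diag_const_mx; congr diag_mx.
by apply/rowP => i; rewrite !mxE mulVf.
Qed.

Lemma col_mul_diag {K : comNzRingType} {p n : nat} (M : 'M[K]_(p, n))
    (d : 'I_n -> K) i :
  col i (M *m diag_mx (\row_j d j)) = d i *: (M *m delta_mx i 0).
Proof.
by rewrite -colE mul_mx_diag; apply/colP => a; rewrite !mxE mulrC.
Qed.

Lemma diag_mx_mulE {K : pzRingType} {n : nat} (d : 'I_n -> K) (X : 'cV[K]_n) i :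
  (diag_mx (\row_j d j) *m X) i 0 = d i * X i 0.
Proof. by rewrite mul_diag_mx !mxE. Qed.

Section Frame.
Context {R : realType} {n k : nat}.
Local Notation m := (n + k)%N.
Local Notation N := (n + m)%N.
Local Notation L := (lorentz R N).
Local Notation J := (lorentz R m).

Lemma lorentz_unit : J \in unitmx.
Proof. by have [] := mulmx1_unit (@lorentzK R m). Qed.

Lemma lorentz_form_inj (y y' : 'cV[R]_m) :
  (forall z : 'cV[R]_m, (z^T *m J *m y) 0 0 = (z^T *m J *m y') 0 0) -> y = y'.
Proof.
move=> yy'; rewrite -[y]mul1mx -[y']mul1mx -(lorentzK m) -!mulmxA.
congr (_ *m _).
apply/colP => a; have := yy' (delta_mx a 0).
by rewrite !trmx_delta -!mulmxA -!rowE [LHS]mxE [X in _ = X -> _]mxE.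
Qed.

Section AdaptedFrame.
Variables (s : 'I_n -> 'I_m) (s' : 'I_k -> 'I_m).
Variables (A : 'cV[R]_n -> 'M[R]_N) (g1 : 'cV[R]_n -> 'M[R]_n)
  (g2 : 'cV[R]_n -> 'M[R]_m)
  (u : 'I_n -> 'cV[R]_n -> 'M[R]_n) (w : 'I_n -> 'cV[R]_n -> 'M[R]_m).

(** The upper right block of the i-th generator of the abelian subalgebra. *)
Definition generator_block (i : 'I_n) : 'M[R]_(n, m) := delta_mx i (s i).
Local Notation E := generator_block.

(** What the geometry needs from the extended flat frame, for both abelian
    subalgebras at once: [s] lists the coordinates of R^(n+k-1,1) met by the
    generators and [s'] the remaining ones; [A] is the frame at spectral
    parameter 1, and [g1], [g2] are the diagonal blocks of the frame at 0, with
    logarithmic derivatives [u], [w]. The last two conditions follow from [u]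
    and [w] being the blocks of brackets of the generators with an element of
    p. *)
Record adapted_frame : Prop := AdaptedFrame {
  af_s_inj : injective s;
  af_s'_inj : injective s';
  af_s_s' : forall i j, s i != s' j;
  af_s_cover : forall a, (exists i, a = s i) \/ (exists j, a = s' j);
  af_lorentz : L = block_mx 1%:M 0 0 J;
  af_smooth_A : smooth_on setT A;
  af_smooth_g1 : smooth_on setT g1;
  af_smooth_g2 : smooth_on setT g2;
  af_A_orth : forall x, (A x)^T *m L *m A x = L;
  af_g1_orth : forall x, (g1 x)^T *m g1 x = 1%:M;
  af_g2_orth : forall x, (g2 x)^T *m J *m g2 x = J;
  af_dA : forall i x,
    pdmx i A x = A x *m block_mx (u i x) (E i) (- (J *m (E i)^T)) (w i x);
  af_dg1 : forall i x, pdmx i g1 x = g1 x *m u i x;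
  af_dg2 : forall i x, pdmx i g2 x = g2 x *m w i x;
  af_uw_sym : forall i j x,
    u i x *m E j - E j *m w i x = u j x *m E i - E i *m w j x;
  af_w_perp : forall i x a b, w i x (s' a) (s' b) = 0 }.

Hypothesis afP : adapted_frame.
Local Notation s_inj := (af_s_inj afP).
Local Notation s'_inj := (af_s'_inj afP).
Local Notation s_s' := (af_s_s' afP).
Local Notation s_cover := (af_s_cover afP).
Local Notation A_orth := (af_A_orth afP).
Local Notation g1_orth := (af_g1_orth afP).
Local Notation g2_orth := (af_g2_orth afP).
Local Notation dA := (af_dA afP).
Local Notation dg1 := (af_dg1 afP).
Local Notation dg2 := (af_dg2 afP).
Local Notation uw_sym := (af_uw_sym afP).
Local Notation w_perp := (af_w_perp afP).
Local Notation L_block := (af_lorentz afP).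
Local Notation sA := (af_smooth_A afP).
Local Notation sg1 := (af_smooth_g1 afP).
Local Notation sg2 := (af_smooth_g2 afP).

(** The first n columns of [A] frame the tangent bundle of every immersion
    [frame_map b] below, and the others frame its normal bundle. *)
Definition tangent_frame x : 'M[R]_(N, n) := lsubmx (A x).
Definition normal_frame x : 'M[R]_(N, m) := rsubmx (A x).
Local Notation Tan := tangent_frame.
Local Notation Nor := normal_frame.

Lemma frame_row_mx x : A x = row_mx (Tan x) (Nor x).
Proof. by rewrite hsubmxK. Qed.

Lemma frame_gram x :
  [/\ (Tan x)^T *m L *m Tan x = 1%:M, (Tan x)^T *m L *m Nor x = 0,
  (Nor x)^T *m L *m Tan x = 0 & (Nor x)^T *m L *m Nor x = J].
Proof.
have := A_orth x.
rewrite frame_row_mx tr_row_mx mul_col_mx mul_col_row [in X in _ = X]L_block.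
by move=> /eq_block_mx.
Qed.

Lemma gramTT x : (Tan x)^T *m L *m Tan x = 1%:M. Proof. by case: (frame_gram x). Qed.
Lemma gramTN x : (Tan x)^T *m L *m Nor x = 0. Proof. by case: (frame_gram x). Qed.
Lemma gramNT x : (Nor x)^T *m L *m Tan x = 0. Proof. by case: (frame_gram x). Qed.
Lemma gramNN x : (Nor x)^T *m L *m Nor x = J. Proof. by case: (frame_gram x). Qed.

Lemma ip_normal_frame x y z : ip (Nor x *m y) (Nor x *m z) = (y^T *m J *m z) 0 0.
Proof.
rewrite /ip; congr (_ _ 0 0); rewrite -(gramNN x).
by rewrite trmx_mul !mulmxA.
Qed.

Lemma smooth_normal_frame : smooth_on setT Nor.
Proof.
have -> : Nor = fun x => mxsub id (@rshift n m) (A x).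
  by apply/funext => x; rewrite /normal_frame rsubmxEsub.
exact/smooth_on_mxsub/sA.
Qed.
Local Notation sNor := smooth_normal_frame.

Lemma pdmx_normal_frame i x : pdmx i Nor x = Tan x *m E i + Nor x *m w i x.
Proof.
have {1}-> : Nor = fun x => mxsub id (@rshift n m) (A x).
  by apply/funext => y; rewrite /normal_frame rsubmxEsub.
rewrite pdmx_mxsub -rsubmxEsub.
by rewrite dA frame_row_mx mul_row_block row_mxKr.
Qed.

(** The inverse of [g2] gauges away [w]: the columns of
    [Nor x *m gauge_inv x] are normal fields without normal derivative. *)
Definition gauge_inv x : 'M[R]_m := invmx (g2 x).
Local Notation q := gauge_inv.

Lemma gauge_unit x : g2 x \in unitmx.
Proof.
have : J *m (g2 x)^T *m J *m g2 x = 1%:M.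
  by rewrite -!mulmxA (mulmxA _ J) g2_orth lorentzK.
by move=> /mulmx1_unit[].
Qed.

Lemma smooth_gauge_inv : smooth_on setT q.
Proof.
have qE x : J *m (g2 x)^T *m J = q x.
  apply: esym; apply: invmx_eq; apply: mulmx1C.
  by rewrite -!mulmxA (mulmxA _ J) g2_orth lorentzK.
apply: (@smooth_on_eq _ _ _ _ setT (fun x => J *m (g2 x)^T *m J)) => //.
  exact: openT.
apply: (smooth_onM openT); last exact: smooth_on_cst.
by apply: (smooth_onM openT); [exact: smooth_on_cst|exact/smooth_on_tr/sg2].
Qed.

Lemma pdmx_gauge_inv i x : pdmx i q x = - (w i x *m q x).
Proof.
have gq y : setT y -> g2 y *m q y = 1%:M by move=> _; rewrite mulmxV ?gauge_unit.
have := eq_pdmx i openT (I : setT x) gq.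
rewrite pdmx_cst (pdmxM i openT (I : setT x) sg2 smooth_gauge_inv) dg2 => /eqP.
rewrite addrC addr_eq0 -mulmxA -mulmxN => /eqP.
by move=> /(congr1 (mulmx (q x))); rewrite !mulKmx ?gauge_unit.
Qed.

Lemma gauge_inv_orth x : (q x)^T *m J *m q x = J.
Proof.
rewrite -{1}(g2_orth x) -!mulmxA mulmxV ?gauge_unit// mulmx1 !mulmxA.
by rewrite -trmx_mul mulmxV ?gauge_unit// trmx1 mul1mx.
Qed.

Section LightlikeVector.
Variable b : 'cV[R]_m.
(** The coordinates of [frame_map] in the normal frame. *)
Definition frame_coord x : 'cV[R]_m := q x *m b.
Local Notation h := frame_coord.

Lemma smooth_frame_coord : smooth_on setT h.
Proof.
by apply: (smooth_onM openT); [exact: smooth_gauge_inv|exact: smooth_on_cst].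
Qed.

Lemma pdmx_frame_coord i x : pdmx i h x = - (w i x *m h x).
Proof.
rewrite (pdmxMr b i openT (I : setT x) smooth_gauge_inv) pdmx_gauge_inv.
by rewrite mulNmx mulmxA.
Qed.

(** The map F of the theorem for the vector [b]. *)
Definition frame_map x : 'cV[R]_N := A x *m col_mx 0 (h x).
Local Notation F := frame_map.

Lemma frame_map_normal x : F x = Nor x *m h x.
Proof. by rewrite /F frame_row_mx mul_row_col mulmx0 add0r. Qed.

Lemma frame_map_smooth : smooth_on setT F.
Proof.
apply: (@smooth_on_eq _ _ _ _ setT (fun x => Nor x *m h x)).
- exact: openT.
- by move=> x _; rewrite frame_map_normal.
- by apply: smooth_onM; [exact: openT|exact: sNor|exact: smooth_frame_coord].
Qed.

Lemma frame_map_light_cone : b != 0 -> ip b b = 0 -> in_light_cone F.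
Proof.
move=> b0 bb x; split.
  apply: contra_neq b0 => F0.
  have /(congr1 (mulmx ((Nor x)^T *m L))) := F0.
  rewrite frame_map_normal mulmx0 mulmxA gramNN => /(congr1 (mulmx (g2 x *m J))).
  by rewrite mulmx0 -!mulmxA (mulmxA J J) lorentzK mul1mx mulKVmx ?gauge_unit.
rewrite frame_map_normal ip_normal_frame -bb /ip -[in RHS](gauge_inv_orth x).
congr (_ _ 0 0); by rewrite trmx_mul !mulmxA.
Qed.

Lemma generator_block_mul i (y : 'cV[R]_m) : E i *m y = y (s i) 0 *: delta_mx i 0.
Proof.
apply/colP => a; rewrite !mxE (bigD1 (s i))//= big1 => [|c ci].
  by rewrite !mxE !eqxx andbT addr0 mulrC.
by rewrite mxE (negPf ci) andbF mul0r.
Qed.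

(** The derivatives of the coordinates [h] cancel the normal part of the
    derivative of the normal frame. *)
Lemma pdmx_frame_map i x : pdmx i F x = h x (s i) 0 *: (Tan x *m delta_mx i 0).
Proof.
have FE y : setT y -> F y = Nor y *m h y by move=> _; exact: frame_map_normal.
rewrite (eq_pdmx i openT (I : setT x) FE).
rewrite (pdmxM i openT (I : setT x) sNor smooth_frame_coord) pdmx_normal_frame.
rewrite pdmx_frame_coord mulmxDl mulmxN -!mulmxA addrK generator_block_mul.
by rewrite scalemxAr.
Qed.

Definition coord_diag x : 'M[R]_n := diag_mx (\row_i h x (s i) 0).
Local Notation D := coord_diag.

Lemma jac_frame_map x : jac F x = Tan x *m D x.
Proof.
apply/matrixP => a i.
have -> : jac F x a i = col i (jac F x) a 0 by rewrite [RHS]mxE.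
rewrite col_jac pdmx_frame_map -(col_mul_diag (Tan x) (fun j => h x (s j) 0)).
by rewrite [LHS]mxE.
Qed.

Local Notation U := [set x | immersion_at F x].

Lemma tangent_frame_inj x (X Y : 'cV[R]_n) : Tan x *m X = Tan x *m Y -> X = Y.
Proof.
by move=> /(congr1 (mulmx ((Tan x)^T *m L))); rewrite !mulmxA gramTT !mul1mx.
Qed.

Lemma frame_immersionP x : U x <-> forall i, h x (s i) 0 != 0.
Proof.
rewrite /U /= /immersion_at jac_frame_map; split=> [rk i|h0].
  have rD : row_full (D x).
    rewrite /row_full eqn_leq rank_leq_col /= -[X in (X <= _)%N]rk.
    exact: mxrankM_maxr.
  move: rD; rewrite row_full_unit unitmxE det_diag unitfE.
  by move=> /prodf_neq0/(_ i isT); rewrite mxE.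
have uD : D x \in unitmx.
  by rewrite unitmxE det_diag unitfE; apply/prodf_neq0 => i _; rewrite mxE.
by rewrite mxrankMfree ?row_free_unit// (rank_spans (gramTT x) (unitmx1 _ _)).
Qed.

Lemma frame_immersion_open : open U.
Proof.
rewrite openE => x /frame_immersionP h0.
have : \forall y \near x, forall i, h y (s i) 0 != 0.
  apply: (@filter_forall _ _ (fun i y => h y (s i) 0 != 0) (nbhs x)) => i.
  have ch : {for x, continuous (fun y => h y (s i) 0)}.
    by apply: smooth_continuous (I : setT x); exact: smooth_frame_coord.
  exact: cvgr_neq0 ch (h0 i).
by apply: filterS => y /frame_immersionP.
Qed.
Local Notation oU := frame_immersion_open.

(** The metric is the pull-back of the Euclidean one by [g1 *m D]; the columns
    of this matrix are [g1 *m E l *m h], and closedness is the symmetry of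
    [u i *m E j - E j *m w i] in i and j. *)
Lemma frame_flat_metric : flat_metric U (induced_metric F).
Proof.
have shi i : smooth U (fun x => h x (s i) 0).
  exact: (smooth_on_setT smooth_frame_coord (s i) 0).
pose P x := g1 x *m D x.
pose Q x := diag_mx (\row_i (h x (s i) 0)^-1) *m (g1 x)^T.
apply: (@flat_metric_coframe R n U P Q (induced_metric F) oU).
- apply: (smooth_onM oU); first exact: smooth_on_setT sg1.
  exact: smooth_on_diag.
- apply: (smooth_onM oU); last by apply: smooth_on_tr; exact: smooth_on_setT sg1.
  apply: smooth_on_diag => i; apply: (smoothV oU _ (shi i)).
  by move=> x /frame_immersionP; exact.
- move=> x /frame_immersionP h0.
  rewrite /Q /P -mulmxA (mulmxA _^T) g1_orth mul1mx.
  exact: diag_mxVK h0.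
- move=> x _; rewrite /induced_metric jac_frame_map /P !trmx_mul -!mulmxA.
  rewrite (mulmxA _ L) (mulmxA _ (Tan x)) gramTT mul1mx.
  by rewrite (mulmxA _ (g1 x)) g1_orth mul1mx.
move=> x i j Ux.
have colPE l y : col l (P y) = g1 y *m (E l *m h y).
  rewrite /P /D (col_mul_diag (g1 y) (fun j => h y (s j) 0)).
  by rewrite generator_block_mul scalemxAr.
have dcol l r : col r (pdmx l P x) =
    g1 x *m ((u l x *m E r - E r *m w l x) *m h x).
  have -> : col r (pdmx l P x) = pdmx l (fun y => g1 y *m (E r *m h y)) x.
    apply/colP => a; rewrite !mxE; congr (pd l _ x); apply/funext => y.
    by rewrite -colPE [RHS]mxE.
  have sEh : smooth_on setT (fun y => E r *m h y).
    apply: (smooth_onM openT); first exact: smooth_on_cst.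
    exact: smooth_frame_coord.
  rewrite (pdmxM l openT (I : setT x) sg1 sEh) dg1.
  rewrite (pdmxMl (E r) l openT (I : setT x) smooth_frame_coord).
  rewrite pdmx_frame_coord.
  by rewrite !mulmxN -!mulmxA -mulmxN -mulmxDr mulmxBl !mulmxA.
by rewrite !dcol uw_sym.
Qed.

Lemma tangent_spans x : U x -> spans (Tan x) (tangent F x).
Proof.
move=> /frame_immersionP h0 t; rewrite /tangent jac_frame_map.
split=> [[X ->]|[a ->]].
  by exists (D x *m X); rewrite mulmxA.
exists (diag_mx (\row_i (h x (s i) 0)^-1) *m a).
rewrite -mulmxA (mulmxA (D x)).
by rewrite (mulmx1C (diag_mxVK h0)) mul1mx.
Qed.

Lemma frame_decomp x (t : 'cV[R]_N) :
  t = Tan x *m ((Tan x)^T *m L *m t) + Nor x *m (J *m ((Nor x)^T *m L *m t)).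
Proof.
have LA : L *m (A x)^T *m L *m A x = 1%:M.
  by rewrite -!mulmxA (mulmxA _ L) A_orth lorentzK.
have := mulmx1C LA; rewrite !mulmxA => E1.
rewrite -[LHS]mul1mx -E1 frame_row_mx tr_row_mx -!mulmxA mul_col_mx L_block.
rewrite [block_mx _ _ _ _ *m col_mx _ _]mul_block_col mul_row_col.
by rewrite mul1mx !mul0mx addr0 add0r.
Qed.

Lemma normal_spans x : U x -> spans (Nor x) (normal F x).
Proof.
move=> Ux t; rewrite /normal (orth_spans _ (tangent_spans Ux)).
split=> [Tt|[a ->]]; last by rewrite mulmxA gramTN mul0mx.
exists (J *m ((Nor x)^T *m L *m t)).
by rewrite {1}[t](frame_decomp x) Tt mulmx0 add0r.
Qed.

Lemma frame_normal_flat V : open V -> V `<=` U -> flat_bundle V (normal F).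
Proof.
move=> oV VU.
apply: (@flat_bundle_parallel _ _ _ _ V _ (fun x => Nor x *m q x) J).
- exact: oV.
- exact: lorentz_unit.
- apply: smooth_on_setT.
  by apply: smooth_onM; [exact: openT|exact: sNor|exact: smooth_gauge_inv].
- move=> x _; rewrite trmx_mul -!mulmxA (mulmxA _ L) (mulmxA _ (Nor x)) gramNN.
  by rewrite mulmxA gauge_inv_orth.
- move=> x i _; rewrite (pdmxM i openT (I : setT x) sNor smooth_gauge_inv).
  rewrite pdmx_normal_frame pdmx_gauge_inv.
  rewrite mulmxN mulmxDl -!mulmxA addrK trmx_mul -!mulmxA (mulmxA _ L).
  by rewrite (mulmxA _ (Tan x)) gramNT mul0mx mulmx0.
move=> x Vx t; rewrite (normal_spans (VU _ Vx)); split=> [[a ->]|[a ->]].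
  by exists (g2 x *m a); rewrite -mulmxA mulKmx ?gauge_unit.
by exists (q x *m a); rewrite mulmxA.
Qed.

(** Its transpose keeps the coordinates listed by [s]. *)
Definition select : 'M[R]_(m, n) := \matrix_(a, i) (a == s i)%:R.
Local Notation S := select.

Lemma tr_select_mul (y : 'cV[R]_m) i : (S^T *m y) i 0 = y (s i) 0.
Proof.
rewrite mxE (bigD1 (s i))//= !mxE eqxx mul1r big1 ?addr0// => a ai.
by rewrite !mxE (negPf ai) mul0r.
Qed.

(** The i-th column lists the coordinates, in the normal frame, of the i-th
    curvature normal: minus the vector dual to the coordinate [s i], divided by
    that coordinate of [h]. *)
Definition curv_normals x : 'M[R]_(m, n) :=
  - (J *m S *m diag_mx (\row_i (h x (s i) 0)^-1)).
Local Notation H := curv_normals.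

Lemma curv_normals_dual x (y : 'cV[R]_m) i :
  (y^T *m J *m col i (H x)) 0 0 = - (y (s i) 0 / h x (s i) 0).
Proof.
rewrite /curv_normals linearN /= mulmxN [LHS]mxE; congr (- _).
rewrite (col_mul_diag _ (fun j => (h x (s j) 0)^-1)) -scalemxAr mxE mulrC.
congr (_ * _).
rewrite -!mulmxA (mulmxA J J) lorentzK mul1mx mulmxA -colE mxE.
rewrite -[LHS]/((y^T *m S) 0 i) -tr_select_mul -[S^T *m y]trmxK.
by rewrite trmx_mul trmxK [RHS]mxE.
Qed.

(** All shape operators are diagonal in the same tangent frame. *)
Lemma frame_shapeE x V (v : 'cV[R]_n -> 'cV[R]_N) y X : U x -> open V -> V x ->
  section_on V (normal F) v -> v x = Nor x *m y ->
  Defs.shape F v x X = - (Tan x *m (diag_mx (\row_i y (s i) 0) *m X)).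
Proof.
move=> Ux oV Vx [sv nv] vy.
rewrite /Defs.shape (oproj_spans _ (gramTT x) (unitmx1 _ _) (tangent_spans Ux)).
rewrite invmx1 mul1mx (mulmxA (_ *m L)); congr (- (_ *m (_ *m _))).
apply/matrixP => a i.
have -> : ((Tan x)^T *m L *m jac v x) a i = ((Tan x)^T *m L *m pdmx i v x) a 0.
  by rewrite -col_jac colE mulmxA -colE [RHS]mxE.
(* On the part of V where F is an immersion, v has smooth coordinates z in the
   normal frame, and only the tangential part of its derivative matters. *)
pose W := V `&` U.
have oW : open W by apply: openI => //; exact: oU.
have Wx : W x by split.
pose z t := J *m ((Nor t)^T *m L *m v t).
have sz : smooth_on W z.
  apply: (smooth_onM oW); first exact: smooth_on_cst.
  apply: (smooth_onM oW); last by apply: smooth_on_sub sv => t [].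
  apply: (smooth_onM oW); last exact: smooth_on_cst.
  by apply: smooth_on_tr; exact: smooth_on_setT sNor.
have vz t : W t -> v t = Nor t *m z t.
  move=> [Vt Ut]; have /(orth_spans _ (tangent_spans Ut)) := nv t Vt.
  by move=> Tv; rewrite {1}[v t](frame_decomp t) Tv mulmx0 add0r.
have zy : z x = y.
  by rewrite /z vy mulmxA gramNN mulmxA lorentzK mul1mx.
rewrite (eq_pdmx i oW Wx vz).
rewrite (pdmxM i oW Wx (smooth_on_setT sNor) sz) pdmx_normal_frame zy.
rewrite !mulmxDr mulmxDl mulmxDr !mulmxA gramTT gramTN !mul0mx !addr0 mul1mx.
rewrite generator_block_mul !mxE andbT.
by case: eqVneq => [->|_]; rewrite ?mulr1 ?mulr0.
Qed.

Lemma eigenvector_coords x V (v : 'cV[R]_n -> 'cV[R]_N) z y X :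
  U x -> open V -> V x -> section_on V (normal F) v -> v x = Nor x *m z ->
  Defs.shape F v x X = ip (v x) (Nor x *m y) *: (jac F x *m X) <->
  forall i, - (z (s i) 0 * X i 0) = (z^T *m J *m y) 0 0 * (h x (s i) 0 * X i 0).
Proof.
move=> Ux oV Vx sv vz; rewrite (frame_shapeE X Ux oV Vx sv vz) vz.
rewrite ip_normal_frame jac_frame_map.
rewrite -mulmxN -(mulmxA (Tan x)) [_ *: (Tan x *m _)]scalemxAr.
set c := ((z^T *m J *m y) 0 0).
have coordE i : (- (diag_mx (\row_i z (s i) 0) *m X) = c *: (D x *m X) ->
    - (z (s i) 0 * X i 0) = c * (h x (s i) 0 * X i 0)).
  move=> /(congr1 (fun t : 'cV[R]_n => t i 0)).
  by rewrite [in X in X = _]mxE [in X in _ = X]mxE !diag_mx_mulE.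
split=> [/tangent_frame_inj E1 i|E1]; first exact: coordE.
congr (_ *m _); apply/colP => i; rewrite [LHS]mxE [RHS]mxE.
rewrite (diag_mx_mulE (fun i => z (s i) 0)).
by rewrite (diag_mx_mulE (fun i => h x (s i) 0)).
Qed.

Lemma curv_eigenspaceP x y X : U x ->
  curv_eigenspace F x (Nor x *m y) X <->
  forall i, X i 0 != 0 -> y = col i (H x).
Proof.
move=> Ux; have h0 := (frame_immersionP x).1 Ux.
split=> [Xe i Xi|yH V v oV Vx sv].
  (* Sections with constant coordinates in the normal frame suffice. *)
  apply: lorentz_form_inj => z.
  have secz : section_on U (normal F) (fun t => Nor t *m z).
    split; last by move=> t Ut; apply/(normal_spans Ut); eexists.
    apply: smooth_on_setT.
    by apply: smooth_onM; [exact: openT|exact: sNor|exact: smooth_on_cst].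
  have := (eigenvector_coords y X Ux oU Ux secz erefl).1 (Xe U _ oU Ux secz) i.
  rewrite curv_normals_dual mulrA -mulNr => /(mulIf Xi) E1.
  by rewrite -mulNr E1 mulfK.
have [z vz] := (normal_spans Ux _).1 (sv.2 x Vx).
apply/(eigenvector_coords y X Ux oV Vx sv vz) => i.
have [->|Xi] := eqVneq (X i 0) 0; first by rewrite !mulr0 oppr0.
by rewrite (yH i Xi) curv_normals_dual mulrA mulNr mulfVK// mulNr.
Qed.

Lemma curv_normals_inj x : U x -> injective (fun i => col i (H x)).
Proof.
move=> /frame_immersionP h0 i j Hij; apply: s_inj.
apply/eqP; apply: contraT => sij.
have {}Hij : col i (H x) = col j (H x) by [].
have := curv_normals_dual x (delta_mx (s i) 0) i.
rewrite Hij curv_normals_dual [delta_mx _ _ (s j) _]mxE.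
rewrite [delta_mx _ _ (s i) _]mxE !eqxx eq_sym (negPf sij) mul0r mul1r => /eqP.
by rewrite eqr_opp eq_sym invr_eq0 (negPf (h0 i)).
Qed.

Lemma curv_eigenspace_line x i X : U x ->
  curv_eigenspace F x (Nor x *m col i (H x)) X <->
  exists a, X = a *: delta_mx i 0.
Proof.
move=> Ux; rewrite (curv_eigenspaceP _ _ Ux); split=> [Xi|[a ->] j].
  exists (X i 0); apply/colP => j; rewrite !mxE andbT.
  have [->|ji] := eqVneq j i; first by rewrite mulr1.
  rewrite mulr0; apply/eqP; apply: contraT => /Xi/(curv_normals_inj Ux) ij.
  by rewrite ij eqxx in ji.
rewrite !mxE andbT; have [->//|_] := eqVneq j i.
by rewrite mulr0 eqxx.
Qed.

Lemma col_curv_normals x i : col i (Nor x *m H x) = Nor x *m col i (H x).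
Proof. by rewrite !colE mulmxA. Qed.

Lemma curvature_normalP x nu : U x ->
  curvature_normal F x nu <-> exists i, nu = Nor x *m col i (H x).
Proof.
move=> Ux; split=> [[/(normal_spans Ux)[y ->] [X X0 Xe]]|[i ->]].
  have /cV0Pn[i Xi] := X0.
  by exists i; rewrite ((curv_eigenspaceP _ _ Ux).1 Xe i Xi).
split; first by apply/(normal_spans Ux); eexists.
exists (delta_mx i 0); last first.
  by apply/(curv_eigenspace_line _ _ Ux); exists 1; rewrite scale1r.
apply/eqP => /(congr1 (fun X : 'cV[R]_n => X i 0)).
by rewrite !mxE !eqxx => /eqP; rewrite oner_eq0.
Qed.

Lemma frame_principalP x X : U x ->
  principal F x X <-> exists i a, a != 0 /\ X = a *: delta_mx i 0.
Proof.
move=> Ux; split=> [[X0 [_ /(curvature_normalP _ Ux)[i ->]]]|[i [a [a0 ->]]]].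
  move=> /(curv_eigenspace_line _ _ Ux)[a Xa]; exists i, a; split=> //.
  by apply: contra_neq X0 => a0; rewrite Xa a0 scale0r.
split.
  apply/eqP => /(congr1 (fun X : 'cV[R]_n => X i 0)).
  by rewrite !mxE !eqxx mulr1 => /eqP; rewrite (negPf a0).
exists (Nor x *m col i (H x)); first by apply/(curvature_normalP _ Ux); exists i.
by apply/(curv_eigenspace_line _ _ Ux); exists a.
Qed.

Lemma frame_uniform_multiplicity_one : uniform_multiplicity_one F U.
Proof.
exists (fun x => Nor x *m H x); split.
  apply: (smooth_onM oU); first exact: smooth_on_setT sNor.
  have -> : H = fun x => (- (J *m S)) *m diag_mx (\row_i (h x (s i) 0)^-1).
    by apply/funext => x; rewrite mulNmx.
  apply: (smooth_onM oU); first exact: smooth_on_cst.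
  apply: smooth_on_diag => i.
  apply: (smoothV oU) => [x /frame_immersionP|]; first exact.
  exact: (smooth_on_setT smooth_frame_coord (s i) 0).
move=> x Ux; split=> [i j|nu|i].
- rewrite !col_curv_normals => /(congr1 (fun t => J *m ((Nor x)^T *m L *m t))).
  rewrite !(mulmxA _ (Nor x)) gramNN !mulmxA lorentzK !mul1mx.
  by move=> /(curv_normals_inj Ux).
- rewrite (curvature_normalP _ Ux).
  by split=> -[i ->]; exists i; rewrite col_curv_normals.
exists (delta_mx i 0).
  apply/eqP => /(congr1 (fun X : 'cV[R]_n => X i 0)).
  by rewrite !mxE !eqxx => /eqP; rewrite oner_eq0.
by move=> Y; rewrite col_curv_normals; exact: curv_eigenspace_line.
Qed.

(** The inclusion of the coordinates listed by [s']. *)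
Definition coselect : 'M[R]_(m, k) := \matrix_(a, j) (a == s' j)%:R.
Local Notation S' := coselect.

Lemma coselect_conj (M : 'M[R]_m) i j : (S'^T *m M *m S') i j = M (s' i) (s' j).
Proof.
rewrite mxE (bigD1 (s' j))//= big1 ?addr0 => [|a aj]; last first.
  by rewrite [X in _ * X]mxE (negPf aj) mulr0.
rewrite [X in _ * X]mxE eqxx mulr1 mxE (bigD1 (s' i))//= big1 ?addr0 => [|a ai].
  by rewrite !mxE eqxx mul1r.
by rewrite !mxE (negPf ai) mul0r.
Qed.

Local Notation G' := (S'^T *m J *m S').

Lemma coselect_gram_unit : G' \in unitmx.
Proof.
pose e (j : 'I_m) : R := if j.+1 == m then -1 else 1.
have -> : G' = diag_mx (\row_j e (s' j)).
  apply/matrixP => i j; rewrite coselect_conj lorentzE !mxE.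
  by rewrite (inj_eq s'_inj).
rewrite unitmxE det_diag unitfE; apply/prodf_neq0 => i _.
by rewrite mxE /e; case: ifP => _; rewrite ?oppr_eq0 oner_eq0.
Qed.

Lemma generator_block_coselect i : E i *m S' = 0.
Proof.
apply/matrixP => a j; rewrite !mxE big1// => b' _; rewrite !mxE.
have [->|] := eqVneq b' (s i); last by rewrite andbF mul0r.
by rewrite (negPf (s_s' _ _)) mulr0.
Qed.

Lemma coselect_spans : spans S' [set y | forall i, y (s i) 0 = 0].
Proof.
move=> y /=; split=> [y0|[a ->] i]; last first.
  by rewrite mxE big1// => j _; rewrite mxE (negPf (s_s' _ _)) mul0r.
exists (\col_j y (s' j) 0); apply/colP => a; rewrite mxE.
have [[i ->]|[j ->]] := s_cover a.
  by rewrite y0 big1// => j _; rewrite mxE (negPf (s_s' _ _)) mul0r.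
rewrite (bigD1 j)//= !mxE eqxx mul1r big1 ?addr0// => l lj.
by rewrite !mxE (inj_eq s'_inj) eq_sym (negPf lj) mul0r.
Qed.

(** The normal fields given by the coordinates listed by [s'] span the bundle
    and are parallel, since [w] vanishes between such coordinates. *)
Lemma frame_Nv_perp_flat : flat_bundle U (Nv_perp F).
Proof.
have sS' : smooth_on setT (fun x => Nor x *m S').
  by apply: smooth_onM; [exact: openT|exact: sNor|exact: smooth_on_cst].
apply: (@flat_bundle_parallel _ _ _ _ U _ (fun x => Nor x *m S') G').
- exact: oU.
- exact: coselect_gram_unit.
- exact: smooth_on_setT sS'.
- move=> x _; rewrite trmx_mul -(gramNN x).
  by rewrite !mulmxA.
- move=> x i _; rewrite (pdmxMr S' i openT (I : setT x) sNor).
  rewrite pdmx_normal_frame mulmxDl.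
  rewrite -(mulmxA (Tan x)) generator_block_coselect mulmx0 add0r trmx_mul.
  have -> : S'^T *m (Nor x)^T *m L *m (Nor x *m w i x *m S') =
      S'^T *m ((Nor x)^T *m L *m Nor x *m w i x) *m S' by rewrite !mulmxA.
  rewrite gramNN; apply/matrixP => a j; rewrite coselect_conj lorentzE mul_diag_mx.
  by rewrite !mxE w_perp mulr0.
move=> x Ux t; have h0 := (frame_immersionP x).1 Ux.
have perpP y : orth (curvature_normal F x) (Nor x *m y) <->
    forall i, y (s i) 0 = 0.
  split=> [yo i|y0 nu /(curvature_normalP _ Ux)[i ->]]; last first.
    by rewrite ip_normal_frame curv_normals_dual y0 mul0r oppr0.
  have /yo : curvature_normal F x (Nor x *m col i (H x)).
    by apply/(curvature_normalP _ Ux); exists i.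
  rewrite ip_normal_frame curv_normals_dual => /eqP.
  rewrite oppr_eq0 mulf_eq0 invr_eq0.
  by rewrite (negPf (h0 i)) orbF => /eqP.
split=> [[/(normal_spans Ux)[y ->] /perpP/coselect_spans[a ->]]|[a ->]].
  by exists a; rewrite mulmxA.
rewrite -mulmxA; split; first by apply/(normal_spans Ux); eexists.
by apply/perpP/coselect_spans; exists a.
Qed.

Lemma frame_jac_delta (x : 'cV[R]_n) (i : 'I_n) :
  jac F x *m (delta_mx i 0 : 'cV[R]_n) =
    h x (s i) 0 *: (Tan x *m (delta_mx i 0 : 'cV[R]_n)).
Proof.
by rewrite -colE jac_frame_map (col_mul_diag _ (fun i => h x (s i) 0)).
Qed.

End LightlikeVector.

(** For every vector the principal directions are the coordinate directions,
    and their images are multiples of the same columns of the tangent frame. *)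
Lemma frame_combescure b b' :
  combescure (frame_map b) (frame_map b')
    ([set x | immersion_at (frame_map b) x] `&`
     [set x | immersion_at (frame_map b') x]).
Proof.
have oV := openI (@frame_immersion_open b) (@frame_immersion_open b').
split.
- split; last by apply: frame_normal_flat => // x [].
  by split=> [|x [//]]; exact/smooth_on_setT/frame_map_smooth.
- split; last by apply: frame_normal_flat => // x [].
  by split=> [|x [//]]; exact/smooth_on_setT/frame_map_smooth.
move=> x X [Ux Ux'] /(frame_principalP _ Ux)[i [a [a0 ->]]].
split; first by apply/(frame_principalP _ Ux'); exists i, a.
have h0 := (frame_immersionP _ _).1 Ux i.
have h'0 := (frame_immersionP _ _).1 Ux' i.
exists (frame_coord b' x (s i) 0 / frame_coord b x (s i) 0).
  by rewrite mulf_neq0// invr_eq0.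
rewrite -!scalemxAr !frame_jac_delta !scalerA; congr (_ *: _).
by rewrite mulrAC mulfVK// mulrC.
Qed.

End AdaptedFrame.
End Frame.

(** * From the extended flat frame to an adapted frame *)

Section LaxPair.
Context {R : realType}.

Lemma toCM p q r (A : 'M[R]_(p, q)) (B : 'M[R]_(q, r)) :
  toC (A *m B) = toC A *m toC B.
Proof. exact: map_mxM. Qed.

Lemma toC_inj p q : injective (@toC R p q).
Proof. by move=> A B; apply: map_mx_inj => a b []. Qed.

Lemma map_Re_toC p q (A : 'M[R]_(p, q)) : map_mx (@complex.Re R) (toC A) = A.
Proof. by apply/matrixP => a b; rewrite !mxE. Qed.

Lemma toC_real p q (M : 'M[R[i]]_(p, q)) :
  map_mx conjc M = M -> M = toC (map_mx (@complex.Re R) M).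
Proof.
move=> /matrixP Mc; apply/matrixP => a b; have := Mc a b; rewrite !mxE.
case: (M a b) => x y /= [] /eqP; rewrite eq_sym -addr_eq0 -mulr2n mulrn_eq0 /=.
by move=> /eqP ->.
Qed.

Lemma toC_lorentz N : toC (lorentz R N) = lorentz R[i] N.
Proof.
apply/matrixP => i j; rewrite !mxE.
by case: ifP => _; [case: ifP => _; rewrite ?rmorphN ?rmorph1|rewrite rmorph0].
Qed.

Lemma lorentz_block (n m : nat) : (0 < m)%N ->
  lorentz R (n + m) = block_mx 1%:M 0 0 (lorentz R m).
Proof.
move=> m0; apply/matrixP => i j.
case: (split_ordP i) => a ->; case: (split_ordP j) => b ->.
- rewrite block_mxEul !mxE (inj_eq (@lshift_inj _ _)).
  case: eqVneq => // _; case: eqP => //= E1.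
  by have := ltn_ord a; rewrite -(ltn_add2r m) -E1 ltnNge -addn1 leq_add2l m0.
- by rewrite block_mxEur !mxE eq_lrshift.
- by rewrite block_mxEdl !mxE eq_rlshift.
by rewrite block_mxEdr !mxE (inj_eq (@rshift_inj _ _)) /= -addnS eqn_add2l.
Qed.

Context {n k : nat}.
Local Notation m := (n + k)%N.
Local Notation N := (n + m)%N.
Local Notation L := (lorentz R N).
Local Notation J := (lorentz R m).

(** The element of p with upper right block [xi]. *)
Definition in_p_block (xi : 'M[R]_(n, m)) : 'M[R]_N :=
  block_mx 0 xi (- (J *m xi^T)) 0.

Lemma lie_in_p (E xi : 'M[R]_(n, m)) : lie (in_p_block E) (in_p_block xi) =
  block_mx (xi *m (J *m E^T) - E *m (J *m xi^T)) 0
    0 (J *m xi^T *m E - J *m E^T *m xi).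
Proof.
rewrite /lie /in_p_block !mulmx_block !mul0mx !mulmx0 !add0r !addr0.
rewrite opp_block_mx add_block_mx !mulmxN !mulNmx !opprK !subr0.
by congr block_mx; rewrite addrC.
Qed.

Lemma lorentz_delta (a : 'I_m) (i : 'I_n) :
  J *m delta_mx a i = J a a *: delta_mx a i.
Proof.
rewrite lorentzE mul_diag_mx; apply/matrixP => b j; rewrite !mxE eqxx mulr1n.
by case: (eqVneq b a) => [->//|]; rewrite !mulr0.
Qed.

Lemma in_p_block_emx (i : 'I_n) (a : 'I_m) :
  in_p_block (delta_mx i a) = emx i (n + a) - J a a *: emx (n + a) i.
Proof.
have lt (x : 'I_n) y : (x == n + y :> nat)%N = false.
  by rewrite ltn_eqF// ltn_addr.
have gt (x : 'I_n) y : (n + y == x :> nat)%N = false by rewrite eq_sym lt.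
rewrite /in_p_block trmx_delta lorentz_delta; apply/matrixP => r t.
case: (split_ordP r) => r' ->; case: (split_ordP t) => t' ->.
- by rewrite block_mxEul !mxE /= !lt andbF mulr0 subr0.
- by rewrite block_mxEur !mxE /= lt eqn_add2l mulr0 subr0.
- by rewrite block_mxEdl !mxE /= gt eqn_add2l sub0r.
by rewrite block_mxEdr !mxE /= !gt andbF mulr0 subr0.
Qed.

(** The two subalgebras differ only in the coordinates [s] that their
    generators meet: the first n ones, or all but the first k. *)
Lemma maximal_abelian_blocks (c : 'I_n -> 'M[R]_N) :
  ((0 < k)%N /\ c = a_plus) \/ c = a_minus ->
  exists (s : 'I_n -> 'I_m) (s' : 'I_k -> 'I_m),
  [/\ injective s, injective s', forall i j, s i != s' j,
      forall a, (exists i, a = s i) \/ (exists j, a = s' j) &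
      forall i, c i = in_p_block (delta_mx i (s i))].
Proof.
case=> [[k0 ->]|->].
  exists (@lshift n k), (@rshift n k); split.
  - exact: lshift_inj.
  - exact: rshift_inj.
  - by move=> i j; rewrite eq_lrshift.
  - by move=> a; case: (split_ordP a) => b ->; [left|right]; exists b.
  move=> i; rewrite in_p_block_emx /a_plus /= mxE eqxx ltn_eqF ?scale1r//.
  by rewrite (leq_ltn_trans (ltn_ord i))// -[X in (X < _)%N]addn0 ltn_add2l.
pose e := addnC k n.
exists (fun i => cast_ord e (rshift k i)), (fun j => cast_ord e (lshift n j)).
split.
- by move=> i j /cast_ord_inj/rshift_inj.
- by move=> i j /cast_ord_inj/lshift_inj.
- by move=> i j; rewrite (inj_eq (@cast_ord_inj _ _ _)) eq_rlshift.
- move=> a; rewrite -(cast_ordKV e a).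
  case: (split_ordP (cast_ord (esym e) a)) => b ->; [right|left]; by exists b.
move=> i; rewrite in_p_block_emx /a_minus.
have -> : (n + cast_ord e (rshift k i) = n + k + i)%N by rewrite /= addnA.
congr (_ - _ *: _); rewrite mxE eqxx /eps /=.
by rewrite -addnS (addnC n k) eqn_add2l.
Qed.

Section Gauge.
Variables (s : 'I_n -> 'I_m) (s' : 'I_k -> 'I_m) (xi : 'M[R]_(n, m)).
Hypotheses (s_inj : injective s) (s_s' : forall i j, s i != s' j).

Let E i : 'M[R]_(n, m) := delta_mx i (s i).
Let bracket i := lie (in_p_block (E i)) (in_p_block xi).

Lemma bracket_block i : bracket i =
  block_mx (ulsubmx (bracket i)) 0 0 (drsubmx (bracket i)).
Proof. by rewrite /bracket lie_in_p block_mxKul block_mxKdr. Qed.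

(** The Jacobi identity for two commuting generators. *)
Lemma bracket_sym i j :
  ulsubmx (bracket i) *m E j - E j *m drsubmx (bracket i) =
  ulsubmx (bracket j) *m E i - E i *m drsubmx (bracket j).
Proof.
have [->//|ij] := eqVneq i j.
have E0 a b : a != b -> (E a)^T *m E b = 0.
  by move=> ab; rewrite trmx_delta mul_delta_mx_0.
have EJ0 a b : a != b -> E a *m (J *m (E b)^T) = 0.
  move=> ab; rewrite trmx_delta lorentz_delta -scalemxAr mul_delta_mx_0 ?scaler0//.
  by rewrite (inj_eq s_inj).
have expand a b : a != b ->
    (xi *m (J *m (E a)^T) - E a *m (J *m xi^T)) *m E b
      - E b *m (J *m xi^T *m E a - J *m (E a)^T *m xi) =
    - (E a *m (J *m xi^T) *m E b + E b *m (J *m xi^T) *m E a).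
  move=> ab; rewrite mulmxBl mulmxBr -(mulmxA xi) -(mulmxA J _^T) E0//.
  rewrite !mulmx0 sub0r (mulmxA (E b) (J *m (E a)^T)) EJ0 1?eq_sym//.
  by rewrite mul0mx subr0 -opprD (mulmxA (E b)).
rewrite /bracket !lie_in_p !block_mxKul !block_mxKdr.
by rewrite (expand _ _ ij) (expand j i) 1?eq_sym// [in RHS]addrC.
Qed.

Lemma bracket_perp i a b : drsubmx (bracket i) (s' a) (s' b) = 0.
Proof.
rewrite /bracket lie_in_p block_mxKdr trmx_delta lorentz_delta.
rewrite -scalemxAl mxE [X in X + _]mxE [X in _ + X]mxE [X in - X]mxE.
rewrite big1 => [|j _]; last first.
  by rewrite [X in _ * X]mxE [s' b == _]eq_sym (negPf (s_s' _ _)) andbF mulr0.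
rewrite [X in _ * X]mxE big1 ?mulr0 ?subr0// => j _.
by rewrite [X in X * _]mxE eq_sym (negPf (s_s' _ _)) mul0r.
Qed.

End Gauge.

Section RealFrame.
Variables (c : 'I_n -> 'M[R]_N) (Xi : 'cV[R]_n -> 'M[R]_N).
Variable Phi : 'cV[R]_n -> R[i] -> 'M[R[i]]_N.
Hypothesis hPhi : extended_flat_frame c Xi Phi.

(** The frame at a real spectral parameter, which is a real matrix. *)
Definition real_frame (r : R) x : 'M[R]_N :=
  map_mx (@complex.Re R) (Phi x (real_complex R r)).

Lemma real_frameE r x : Phi x (real_complex R r) = toC (real_frame r x).
Proof.
have [_ _ _ conjP _] := hPhi; apply: toC_real; rewrite conjP; congr (Phi x _).
by rewrite /= oppr0.
Qed.

Lemma real_frame_smooth r : smooth_on setT (real_frame r).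
Proof. by have [/(_ (real_complex R r))[]] := hPhi. Qed.

Lemma real_frame_orth r x : (real_frame r x)^T *m L *m real_frame r x = L.
Proof.
have [_ orthP _ _ _] := hPhi; apply: toC_inj; rewrite !toCM toC_lorentz.
by rewrite -[toC _^T]map_trmx -/(toC _) -real_frameE.
Qed.

Lemma real_frame_pdmx r i x : pdmx i (real_frame r) x =
  real_frame r x *m (r *: c i + lie (c i) (Xi x)).
Proof.
have [_ orthP laxP _ _] := hPhi.
have uPhi : Phi x (real_complex R r) \in unitmx.
  have : lorentz R[i] N *m (Phi x (real_complex R r))^T *m lorentz R[i] N
      *m Phi x (real_complex R r) = 1%:M.
    rewrite -!mulmxA (mulmxA _^T) orthP -toC_lorentz -toCM lorentzK.
    exact: map_mx1.
  by move=> /mulmx1_unit[].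
have := laxP x (real_complex R r) i.
move=> /(congr1 (mulmx (Phi x (real_complex R r)))); rewrite mulKVmx//.
have -> : lax c Xi (real_complex R r) i x = toC (r *: c i + lie (c i) (Xi x)).
  rewrite /lax /toC [RHS]map_mxD; congr (_ + _).
  apply/matrixP => a b; rewrite !mxE; apply: esym.
  exact: (rmorphM (real_complex R)).
rewrite real_frameE -toCM => /(congr1 (map_mx (@complex.Re R))).
rewrite map_Re_toC => <-; apply/matrixP => a b; rewrite !mxE /=.
by congr (pd i _ x); apply/funext => y; rewrite mxE.
Qed.

(** At spectral parameter 0 the frame is fixed by tau. *)
Lemma real_frame0_block x : real_frame 0 x =
  block_mx (ulsubmx (real_frame 0 x)) 0 0 (drsubmx (real_frame 0 x)).
Proof.
have [_ _ _ _ /(_ x 0)] := hPhi; rewrite oppr0 /tau.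
pose rhoR : 'M[R]_N := block_mx 1%:M 0 0 (- 1%:M).
have -> : rho = toC rhoR.
  by rewrite /rho /toC map_block_mx map_mxN !map_mx1 !map_mx0.
have rho2 : rhoR *m rhoR = 1%:M.
  rewrite mulmx_block !mul0mx !mulmx0 !addr0 add0r mulmxN mulNmx opprK !mulmx1.
  by rewrite -scalar_mx_block.
have -> : invmx (toC rhoR) = toC rhoR.
  by apply: invmx_eq; rewrite -toCM rho2; exact: map_mx1.
have := real_frameE 0 x; rewrite rmorph0 => ->; rewrite -!toCM => /toC_inj.
rewrite -{1 2}[real_frame 0 x]submxK !mulmx_block.
rewrite !mul0mx !mulmx0 !mul1mx !mulmx1 !add0r !addr0 !mulNmx !mulmxN.
rewrite !mul1mx !mulmx1.
move=> /eq_block_mx[_ Eur Edl _].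
have opp0 p q (M : 'M[R]_(p, q)) : - M = M -> M = 0.
  move=> /matrixP MM; apply/matrixP => a b; have /eqP := MM a b.
  by rewrite !mxE eqNr => /eqP.
by rewrite -{1}[real_frame 0 x]submxK (opp0 _ _ _ Eur) (opp0 _ _ _ Edl).
Qed.

End RealFrame.
End LaxPair.

Theorem theorem4p3 (R : realType) (n k : nat) (n_gt0 : (0 < n)%N)
  (c : 'I_n -> 'M[R]_(n + (n + k)))
  (hc : ((0 < k)%N /\ c = a_plus) \/ c = a_minus)
  (Xi : 'cV[R]_n -> 'M[R]_(n + (n + k))) (hXi : system_solution c Xi)
  (Phi : 'cV[R]_n -> R[i] -> 'M[R[i]]_(n + (n + k)))
  (hPhi : extended_flat_frame c Xi Phi)
  (cc : 'cV[R]_(n + k)) (cc_neq0 : cc != 0) (cc_null : ip cc cc = 0) :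
  exists (g1 : 'cV[R]_n -> 'M[R]_n) (g2 : 'cV[R]_n -> 'M[R]_(n + k)),
    (forall x, [/\ Phi x 0 = toC (block_mx (g1 x) 0 0 (g2 x)),
       (g1 x)^T *m g1 x = 1%:M &
       (g2 x)^T *m lorentz R (n + k) *m g2 x = lorentz R (n + k)]) /\
    exists F : 'cV[R]_(n + k) -> 'cV[R]_n -> 'cV[R]_(n + (n + k)),
      let U b := [set x | immersion_at (F b) x] in
      [/\ forall b x,
            toC (F b x) = Phi x 1 *m toC (col_mx 0 (invmx (g2 x) *m b)),
          smooth_on setT (F cc) /\ in_light_cone (F cc),
          [/\ flat_metric (U cc) (induced_metric (F cc)),
              flat_bundle (U cc) (normal (F cc)),
              uniform_multiplicity_one (F cc) (U cc) &
              flat_bundle (U cc) (Nv_perp (F cc))] &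
          forall bb : 'cV[R]_(n + k), bb != 0 -> ip bb bb = 0 -> bb != cc ->
            combescure (F cc) (F bb) (U cc `&` U bb)].
Proof.
have m_gt0 : (0 < n + k)%N by rewrite addn_gt0 n_gt0.
have L_block := @lorentz_block R n (n + k) m_gt0.
have [s [s' [s_inj s'_inj s_s' s_cover cE]]] := maximal_abelian_blocks hc.
have [_ Xi_p _] := hXi.
pose A := real_frame Phi 1; pose B := real_frame Phi 0.
(* The frame at 0 solves the equation of the Lax pair without its lambda term,
   so that its blocks have the blocks of the brackets as logarithmic
   derivatives. *)
pose g1 x := ulsubmx (B x); pose g2 x := drsubmx (B x).
have BE x : B x = block_mx (g1 x) 0 0 (g2 x) := real_frame0_block hPhi x.
pose bracket i x := lie (c i) (Xi x).
pose u i x := ulsubmx (bracket i x); pose w i x := drsubmx (bracket i x).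
have bracketP x : exists xi, forall j, bracket j x =
    lie (in_p_block (delta_mx j (s j))) (in_p_block xi).
  by have [_ [xi XiE]] := Xi_p x; exists xi => j; rewrite /bracket cE XiE.
have bracketE i x : bracket i x = block_mx (u i x) 0 0 (w i x).
  by have [xi E] := bracketP x; rewrite /u /w !E; exact: bracket_block.
have sB : smooth_on setT B by exact: real_frame_smooth hPhi 0.
have g1E : g1 = fun x => mxsub (lshift (n + k)) (lshift (n + k)) (B x).
  by apply/funext => x; rewrite /g1 ulsubmxEsub.
have g2E : g2 = fun x => mxsub (@rshift n (n + k)) (@rshift n (n + k)) (B x).
  by apply/funext => x; rewrite /g2 drsubmxEsub.
have dB i x : pdmx i B x = block_mx (g1 x *m u i x) 0 0 (g2 x *m w i x).
  rewrite (real_frame_pdmx hPhi) scale0r add0r -/(bracket i x) bracketE.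
  by rewrite -/(B x) BE mulmx_block !mul0mx !mulmx0 !addr0 !add0r.
have B_orth x : (g1 x)^T *m g1 x = 1%:M /\
    (g2 x)^T *m lorentz R (n + k) *m g2 x = lorentz R (n + k).
  have := real_frame_orth hPhi 0 x; rewrite -/(B x) BE L_block.
  rewrite tr_block_mx !trmx0 !mulmx_block !mul0mx !mulmx0 !add0r !addr0.
  by rewrite mulmx1 => /eq_block_mx[].
have afP : adapted_frame s s' A g1 g2 u w.
  split; [exact: s_inj|exact: s'_inj|exact: s_s'|exact: s_cover
    |exact: L_block|..].
  - exact: real_frame_smooth hPhi 1.
  - by rewrite g1E; exact: smooth_on_mxsub.
  - by rewrite g2E; exact: smooth_on_mxsub.
  - exact: real_frame_orth hPhi 1.
  - by move=> x; have [] := B_orth x.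
  - by move=> x; have [] := B_orth x.
  - move=> i x; rewrite (real_frame_pdmx hPhi) scale1r -/(bracket i x) bracketE.
    by rewrite cE /in_p_block add_block_mx !add0r !addr0.
  - by move=> i x; rewrite {1}g1E pdmx_mxsub -ulsubmxEsub dB block_mxKul.
  - by move=> i x; rewrite {1}g2E pdmx_mxsub -drsubmxEsub dB block_mxKdr.
  - move=> i j x; have [xi E] := bracketP x.
    by rewrite /u /w !E; exact: bracket_sym.
  - move=> i x a b; have [xi E] := bracketP x.
    by rewrite /w E; exact: bracket_perp.
exists g1, g2; split=> [x|].
  have [g1o g2o] := B_orth x; split=> //.
  by rewrite -BE -(real_frameE hPhi) rmorph0.
exists (frame_map A g2) => U; split.
- by move=> b x; rewrite /frame_map toCM -(real_frameE hPhi) rmorph1.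
- split; first exact: frame_map_smooth afP cc.
  exact: frame_map_light_cone afP _ _ _.
- split; [exact: frame_flat_metric afP cc|
    |exact: frame_uniform_multiplicity_one afP cc
    |exact: frame_Nv_perp_flat afP cc].
  by apply: (frame_normal_flat afP) => //; exact: (frame_immersion_open afP).
move=> bb _ _ _; exact: frame_combescure afP cc bb.
Qed.
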